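(* Let $X$ be a complex Banach space with open unit ball $\mathbb{B}$. Let $h\in\mathcal{M}$, with $h(x)=x+\sum_{k=2}^\infty H_k(x)$ its series of homogeneous polynomials near the origin, and let $\{u_t\}_{t\ge0}$ be the semigroup generated by $h$. Then for every $e\in\partial\mathbb{B}$ and every $t\ge0$, $$\frac1{2!}D^2u_t(0)[e^2]=\exp(-t)\,(\exp(-t)-1)\cdot H_2(e),$$ $$\frac1{3!}D^3u_t(0)[e^3]=\frac{\exp(-t)\,(\exp(-2t)-1)}{2}\cdot\Psi_e(h,\lambda,\lambda),$$ where $\lambda=\dfrac{2(1-\exp(-t))}{1+\exp(-t)}$.
   Context: Notation: $X^*$ is the dual space with pairing $\langle x,a\rangle$, $J(x)=\{x^*\in X^*:\|x^*\|=\|x\|,\ \langle x,x^*\rangle=\|x\|^2\}$. $\mathrm{Hol}(\mathbb{B},Y)$ is the set of holomorphic (Fréchet differentiable) mappings $\mathbb{B}\to Y$; $\mathcal{A}(\mathbb{B})$ is the set of $f\in\mathrm{Hol}(\mathbb{B},X)$ with $f(0)=0$, $Df(0)=\mathrm{Id}$. $D^kf(0)$ is the $k$-th Fréchet derivative at $0$ (bounded symmetric $k$-linear operator); $H_k(x)=\frac1{k!}D^kh(0)[x^k]$. $\mathcal{M}=\{h\in\mathcal{A}(\mathbb{B}):\ \mathrm{Re}\langle h(x),x^*\rangle\ge0\text{ for all }x\in\mathbb{B}\setminus\{0\},\ x^*\in J(x)\}$. Each $h\in\mathcal{M}$ is a semigroup generator: for every $x\in\mathbb{B}$ the initial value problem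 $\frac{\partial u_t(x)}{\partial t}+h(u_t(x))=0$, $u_0(x)=x$, has a unique solution $u_t(x)\in\mathbb{B}$ for all $t\ge0$; the family $\{u_t\}_{t\ge0}\subset\mathrm{Hol}(\mathbb{B},\mathbb{B})$ is the semigroup generated by $h$. Fekete–Szegő mapping (with $e^*\in J(e)$ fixed): $$\Psi_e(h,\lambda,\mu)=H_3(e)-\frac{\mu}{2}D^2h(0)[e,H_2(e)]-(\lambda-\mu)\langle H_2(e),e^*\rangle H_2(e),$$ so that $\Psi_e(h,\lambda,\lambda)=H_3(e)-\frac{\lambda}{2}D^2h(0)[e,H_2(e)]$. *)

(* Defs.v *)
From HB Require Import structures.
From mathcomp Require Import all_boot all_order all_algebra.
From mathcomp Require Import all_classical all_reals all_analysis.
From mathcomp Require Export complex.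

Set Implicit Arguments.
Unset Strict Implicit.
Unset Printing Implicit Defensive.

Import Order.TTheory GRing.Theory Num.Theory.
Import numFieldNormedType.Exports.

Local Open Scope classical_set_scope.
Local Open Scope ring_scope.
Local Open Scope complex_scope.

(* The normed space L(X, Y) of bounded linear operators.  The field of scalars
   of a complex normed module is R[i], which is also where norms take their
   (nonnegative real) values. *)
Section BoundedOperators.
Variables (R : realType) (X Y : normedModType R[i]).
Implicit Types (f g : X -> Y).

Definition is_bounded_linear f := linear f /\ continuous f.

Definition bounded_linear_pred : {pred X -> Y} :=
  fun f => `[< is_bounded_linear f >].

Record bounded_operator := BoundedOperator {
  bounded_operator_fun :> X -> Y;
  bounded_operatorP : bounded_operator_fun \in bounded_linear_pred }.

HB.instance Definition _ := [isSub for bounded_operator_fun].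
HB.instance Definition _ := [Choice of bounded_operator by <:].

Lemma bounded_linear_submod : submod_closed bounded_linear_pred.
Proof.
split.
  apply/asboolP; split => [a u v|]; first by rewrite scaler0 addr0.
  exact: cst_continuous.
move=> a f g /asboolP[lf cf] /asboolP[lg cg]; apply/asboolP; split.
  move=> b u v; rewrite !fctE lf lg !scalerDr !scalerA (mulrC b a).
  by rewrite addrACA.
move=> x; apply: (@continuousD _ _ _ (a *: f) g); last exact: cg.
exact: (@continuousZl_tmp _ _ _ f a x (cf x)).
Qed.

HB.instance Definition _ :=
  GRing.isSubmodClosed.Build R[i] (X -> Y) bounded_linear_pred
    bounded_linear_submod.
HB.instance Definition _ :=
  [SubChoice_isSubLmodule of bounded_operator by <:].

Lemma bounded_operator_linear (f : bounded_operator) : linear f.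
Proof. by case: f => f /= /asboolP[]. Qed.

Lemma bounded_operator_continuous (f : bounded_operator) : continuous f.
Proof. by case: f => f /= /asboolP[]. Qed.

HB.instance Definition _ (f : bounded_operator) :=
  GRing.isLinear.Build R[i] X Y *:%R f (@bounded_operator_linear f).

Implicit Types (L : bounded_operator).

(* sup of |L x| over the closed unit ball; the supremum is taken in R since
   R[i] is only partially ordered. *)
Definition opnorm L : R :=
  sup [set complex.Re `|L x| | x in [set x : X | `|x| <= 1]].

Let ReK (Z : normedModType R[i]) (x : Z) : (complex.Re `|x|)%:C = `|x|.
Proof. by rewrite RRe_real// ger0_real. Qed.

Lemma opnorm_has_sup L :
  has_sup [set complex.Re `|L x| | x in [set x : X | `|x| <= 1]].
Proof.
split; first by exists (complex.Re `|L 0|); exists 0 => //=; rewrite normr0.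
have /linear_boundedP : bounded_near L (nbhs (0 : X)).
  by apply: continuous_linear_bounded; exact: bounded_operator_continuous.
move=> /pinfty_ex_gt0[M M0 LM]; exists (complex.Re M) => _ [x /= x1 <-].
rewrite -lecR ReK RRe_real ?gtr0_real//.
by rewrite (le_trans (LM x))// ler_piMr// ltW.
Qed.

Lemma opnorm_ge0 L : 0 <= opnorm L.
Proof.
have /sup_upper_bound/ubP -> // := opnorm_has_sup L.
by exists 0 => /=; rewrite ?normr0// linear0 normr0.
Qed.

Lemma opnorm_ub L x : `|L x| <= (opnorm L)%:C * `|x|.
Proof.
have [->|x0] := eqVneq x 0; first by rewrite linear0 !normr0 mulr0.
have nx : 0 < `|x| by rewrite normr_gt0.
have /sup_upper_bound/ubP/(_ (complex.Re `|L (`|x|^-1 *: x)|)) := opnorm_has_sup L.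
have -> : L (`|x|^-1 *: x) = `|x|^-1 *: L x by rewrite linearZ.
have H : [set complex.Re `|L x| | x in [set x : X | `|x| <= 1]] (complex.Re `| `|x|^-1 *: L x|).
  exists (`|x|^-1 *: x) => /=; first by rewrite normfZV.
  by rewrite linearZ.
move=> /(_ H); rewrite -lecR ReK normrZ normfV normr_id.
by rewrite ler_pdivrMl// mulrC.
Qed.

Lemma opnorm_le L (c : R) : 0 <= c ->
  (forall x, `|L x| <= c%:C * `|x|) -> opnorm L <= c.
Proof.
move=> c0 Lc; apply: ge_sup; first by case: (opnorm_has_sup L).
move=> _ [x /= x1 <-]; rewrite -lecR ReK (le_trans (Lc x))//.
by rewrite ler_piMr// lecR.
Qed.

Lemma opnormD L1 L2 :
  (opnorm (L1 + L2))%:C <= (opnorm L1)%:C + (opnorm L2)%:C.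
Proof.
rewrite -rmorphD lecR; apply: opnorm_le => [|x].
  by apply: addr_ge0; exact: opnorm_ge0.
rewrite rmorphD mulrDl (le_trans (ler_normD _ _))//.
by rewrite lerD// opnorm_ub.
Qed.

Let opnormZ_le (a : R[i]) L : (opnorm (a *: L))%:C <= `|a| * (opnorm L)%:C.
Proof.
have [r ra] : exists r : R, `|a| = r%:C.
  by exists (complex.Re `|a|); rewrite RRe_real// ger0_real.
have r0 : 0 <= r by rewrite -lecR -ra; exact: normr_ge0.
rewrite ra -rmorphM lecR; apply: opnorm_le => [|x].
  exact: mulr_ge0 r0 (opnorm_ge0 _).
have -> : (r * opnorm L)%:C = `|a| * (opnorm L)%:C by rewrite ra -rmorphM.
by rewrite normrZ -mulrA ler_wpM2l// opnorm_ub.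
Qed.

Lemma opnormZ (a : R[i]) L : (opnorm (a *: L))%:C = `|a| * (opnorm L)%:C.
Proof.
apply/eqP; rewrite eq_le opnormZ_le/=.
have [->|a0] := eqVneq a 0.
  by rewrite normr0 mul0r lecR opnorm_ge0.
rewrite -ler_pdivlMl ?normr_gt0// -normfV.
by rewrite -{1}(scalerK a0 L) opnormZ_le.
Qed.

Lemma opnorm_eq0 L : (opnorm L)%:C = 0 -> L = 0.
Proof.
move=> L0; apply/val_inj/funext => x /=; apply/normr0_eq0/eqP.
by rewrite eq_le normr_ge0 andbT (le_trans (opnorm_ub L x))// L0 mul0r.
Qed.

HB.instance Definition _ :=
  Lmodule_isNormed.Build R[i] bounded_operator opnormD opnormZ opnorm_eq0.

Lemma bounded_operator_normE L : `|L| = (opnorm L)%:C.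
Proof. by []. Qed.

End BoundedOperators.

Section FrechetDerivatives.
Variables (R : realType) (X : normedModType R[i]).

(* The Frechet derivative as an element of L(X, Y); it is 0 at points where f
   is not differentiable. *)
Definition frechetD (Y : normedModType R[i]) (f : X -> Y) (x : X) :
    bounded_operator X Y :=
  insubd (0 : bounded_operator X Y) ('d f x : X -> Y).

Lemma frechetDE (Y : normedModType R[i]) (f : X -> Y) (x : X) :
  differentiable f x -> frechetD f x = 'd f x :> (X -> Y).
Proof.
move=> /diff_continuous cf; rewrite /frechetD /insubd insubT//.
by apply/asboolP; split => //; exact: linearP.
Qed.

Variable Y : normedModType R[i].

(* L(X, L(X, ... L(X, Y))), which is isometrically the space of bounded
   k-linear operators from X to Y. *)
Fixpoint multilinear (k : nat) : normedModType R[i] :=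
  if k is k'.+1 then bounded_operator X (multilinear k') else Y.

Fixpoint multilinear_app (k : nat) : multilinear k -> k.-tuple X -> Y :=
  match k with
  | 0 => fun A _ => A
  | k'.+1 => fun A v =>
      multilinear_app ((A : bounded_operator X (multilinear k')) (thead v))
        (behead_tuple v)
  end.

Fixpoint frechetDn (k : nat) (f : X -> Y) : X -> multilinear k :=
  match k with
  | 0 => f
  | k'.+1 => frechetD (frechetDn k' f)
  end.

(* D^k f(0)[v_1, ..., v_k] *)
Definition Dn0 (k : nat) (f : X -> Y) (v : k.-tuple X) : Y :=
  multilinear_app (frechetDn k f 0) v.

(* D^k f(0)[x^k] / k! *)
Definition homogeneous_part (f : X -> Y) (k : nat) (x : X) : Y :=
  (k`!%:R)^-1 *: Dn0 f [tuple of nseq k x].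

End FrechetDerivatives.

Section Generators.
Variables (R : realType) (X : normedModType R[i]).

Definition unit_ball : set X := ball (0 : X) 1.

(* A mapping defined on the unit ball is represented by a function on X whose
   values outside the ball are irrelevant. *)
Definition Hol (Y : normedModType R[i]) : set (X -> Y) :=
  [set f | forall x, unit_ball x -> differentiable f x].

Definition Hol_self : set (X -> X) :=
  [set f | Hol f /\ forall x, unit_ball x -> unit_ball (f x)].

Definition normalized_Hol : set (X -> X) :=
  [set f | [/\ Hol f, f 0 = 0 & 'd f 0 = id :> (X -> X)]].

Definition dual : normedModType R[i] := bounded_operator X R[i]^o.

Definition dual_pairing (x : X) (xs : dual) : R[i] :=
  (xs : bounded_operator X R[i]^o) x.

Definition duality_map (x : X) : set dual :=
  [set xs | `|xs| = `|x| /\ dual_pairing x xs = `|x| ^+ 2].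

Definition class_M : set (X -> X) :=
  [set h | normalized_Hol h /\
    forall x, unit_ball x -> x != 0 ->
    forall xs, duality_map x xs -> 0 <= complex.Re (dual_pairing (h x) xs)].

(* The time derivative is with respect to real t, over which X is not
   registered as a normed module, hence the explicit difference quotient; it is
   one-sided at t = 0. *)
Definition solves_ivp (h : X -> X) (v : R -> X) (x : X) : Prop :=
  v 0 = x /\
  forall t : R, 0 <= t ->
    ((s - t)%:C)^-1 *: (v s - v t) @[s --> within [set s | 0 <= s] t^']
      --> - h (v t).

Definition semigroup_generated_by (h : X -> X) (u : R -> X -> X) : Prop :=
  (forall t : R, 0 <= t -> Hol_self (u t)) /\
  (forall x, unit_ball x -> solves_ivp h (u^~ x) x).

Definition Fekete_Szego (e : X) (es : dual) (h : X -> X) (lambda mu : R[i]) : X :=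
  homogeneous_part h 3 e
  - (mu / 2) *: Dn0 h [tuple e; homogeneous_part h 2 e]
  - ((lambda - mu) * dual_pairing (homogeneous_part h 2 e) es)
      *: homogeneous_part h 2 e.

End Generators.

(* Main.v *)
(* A holomorphic map between complex Banach spaces is infinitely Frechet
   differentiable.  This rests on a Cauchy estimate for the derivative, obtained
   from Goursat's argument applied to dyadic midpoint sums along triangles: no
   integral is needed, because the sums over a triangle are exactly the sums over
   its four midpoint subtriangles.  The Cauchy estimate makes [x |-> Df(x) v] a
   locally uniform limit of holomorphic difference quotients, hence holomorphic,
   and then bounds the second order remainder of [f], whose derivative is the
   remainder of [Df].

   Writing [q = exp (- t)], the cubic curve
     [w(t) = z q e + z^2 (q^2 - q) H2 + z^3 ((q^3 - q)/2 H3
             + (q^3/2 - q^2 + q/2) D^2h(0)[e, H2])]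
   satisfies [w' + h(w) = o(z^3)] uniformly on bounded time intervals, so that by
   Gronwall's argument [u_t(z e) = w(t) + o(z^3)]; the coefficients of [z^2] and
   [z^3] are then those of the Taylor expansion of [u_t]. *)

(* The coefficients of the curve come from solving the equation order by order with [q] as time
   variable ([dq/dt = - q], and [q = 1] at time 0). At order 3 the factor of [D^2h(0)[e, H2]] is
   [q (1 - q)^2 / 2]; writing it as [- lambda / 2] times the factor [(q^3 - q) / 2] of [H3] forces
   [lambda = 2 (1 - q) / (1 + q)].

   The initial value problem cannot simply be differentiated in [x]: the semigroup is given as
   differentiable in time for each fixed [x] and as holomorphic in [x] for each fixed [t], with no
   joint regularity. Comparing it with an explicit curve avoids mixed derivatives and uses only a
   Lipschitz bound and a Taylor expansion of [h] near 0.

   Second and third derivatives are derivatives of maps into spaces of operators. The facts on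
   holomorphic maps are therefore proved for every sequentially complete target, and this property
   is shown to pass from [Y] to the bounded operators into [Y]. *)
From HB Require Import structures.
Require Import Defs.
From mathcomp Require Import all_boot all_order all_algebra.
From mathcomp Require Import all_classical all_reals all_analysis.
From mathcomp Require Import complex.
From mathcomp Require Import ring lra.
Import Order.TTheory GRing.Theory Num.Theory.
Import numFieldNormedType.Exports.
Local Open Scope classical_set_scope.
Local Open Scope ring_scope.
Local Open Scope complex_scope.

Set Implicit Arguments.
Unset Strict Implicit.
Unset Printing Implicit Defensive.

(** * Real-valued norms and moduli *)

(* [R[i]] is only partially ordered; taking norms in [R] gives access to the
   order tactics. *)
Definition nrm (R : realType) (Y : normedModType R[i]) (x : Y) : R :=
  complex.Re `|x|.

Definition modc (R : realType) (a : R[i]) : R := complex.Re `|a|.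

Section RealNorm.
Variables (R : realType) (Y : normedModType R[i]).
Implicit Types (x y : Y) (a : R[i]).

Lemma nrmC x : `|x| = (nrm x)%:C.
Proof. by rewrite /nrm RRe_real// ger0_real. Qed.

Lemma nrm_ge0 x : 0 <= nrm x.
Proof. by rewrite -lecR -nrmC normr_ge0. Qed.

Lemma nrm0 : nrm (0 : Y) = 0.
Proof. by rewrite /nrm normr0. Qed.

Lemma nrm0_eq0 x : nrm x = 0 -> x = 0.
Proof. by move=> x0; apply: normr0_eq0; rewrite nrmC x0. Qed.

Lemma nrmD x y : nrm (x + y) <= nrm x + nrm y.
Proof. by rewrite -lecR rmorphD /= -!nrmC ler_normD. Qed.

Lemma nrmN x : nrm (- x) = nrm x.
Proof. by rewrite /nrm normrN. Qed.

Lemma nrmB x y : nrm (x - y) = nrm (y - x).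
Proof. by rewrite -nrmN opprB. Qed.

Lemma nrm_sub_le x y : nrm (x - y) <= nrm x + nrm y.
Proof. by rewrite -(nrmN y) nrmD. Qed.

Lemma nrm_tri (x y z : Y) : nrm (x - z) <= nrm (x - y) + nrm (y - z).
Proof. by rewrite -[x - z](subrKA y) nrmD. Qed.

Lemma nrm_le_sub x y : nrm x <= nrm (x - y) + nrm y.
Proof. by rewrite -{1}(subrK y x) nrmD. Qed.

Lemma modcC a : `|a| = (modc a)%:C.
Proof. by rewrite /modc RRe_real// ger0_real. Qed.

Lemma nrmZ a x : nrm (a *: x) = modc a * nrm x.
Proof. by apply: complexI; rewrite rmorphM /= -!nrmC -modcC normrZ. Qed.

Lemma nrm_le_eps x : (forall e, 0 < e -> nrm x <= e) -> x = 0.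
Proof.
move=> xe; apply: nrm0_eq0; apply/eqP; rewrite eq_le nrm_ge0 andbT.
by apply/ler_addgt0Pr => e e0; rewrite add0r xe.
Qed.

Lemma nrm_lt_ball x (e : R) : ball (0 : Y) e%:C x = (nrm x < e) :> Prop.
Proof. by rewrite -ball_normE /= sub0r normrN nrmC ltcR. Qed.

Lemma nbhs0_nrm (P : Y -> Prop) :
  (\forall v \near (0 : Y), P v) <->
  exists2 d : R, 0 < d & forall v, nrm v < d -> P v.
Proof.
split=> [/nbhs_ballP[d /= d0 dP]|[d d0 dP]].
  have dE : (complex.Re d)%:C = d by rewrite RRe_real// gtr0_real.
  exists (complex.Re d); first by rewrite -ltcR dE.
  by move=> v vd; apply: dP; rewrite -dE nrm_lt_ball.
apply/nbhs_ballP; exists d%:C; first by rewrite /= ltcR.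
by move=> v; rewrite nrm_lt_ball => /dP.
Qed.

End RealNorm.

Section Modulus.
Variable R : realType.
Implicit Types (a b z : R[i]) (r : R).

Lemma modc_ge0 a : 0 <= modc a.
Proof. exact: (@nrm_ge0 R R[i]^o). Qed.

Lemma modc0 : modc (0 : R[i]) = 0.
Proof. exact: (@nrm0 R R[i]^o). Qed.

Lemma modcD a b : modc (a + b) <= modc a + modc b.
Proof. exact: (@nrmD R R[i]^o). Qed.

Lemma modcN a : modc (- a) = modc a.
Proof. exact: (@nrmN R R[i]^o). Qed.

Lemma modcB a b : modc (a - b) = modc (b - a).
Proof. exact: (@nrmB R R[i]^o). Qed.

Lemma modc_sub_le a b : modc (a - b) <= modc a + modc b.
Proof. exact: (@nrm_sub_le R R[i]^o). Qed.

Lemma modcM a b : modc (a * b) = modc a * modc b.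
Proof. exact: (@nrmZ R R[i]^o). Qed.

Lemma modc_real r : modc r%:C = `|r|.
Proof. by rewrite /modc normc_def /= expr0n/= addr0 sqrtr_sqr. Qed.

Lemma modc1 : modc (1 : R[i]) = 1.
Proof. by rewrite (_ : 1 = (1 : R)%:C)// modc_real normr1. Qed.

Lemma modcV a : modc a^-1 = (modc a)^-1.
Proof. by rewrite /modc normfV modcC -fmorphV. Qed.

Lemma modcX a n : modc (a ^+ n) = modc a ^+ n.
Proof. by elim: n => [|n IH]; rewrite ?expr0 ?modc1// !exprS modcM IH. Qed.

Lemma modc_eq0 a : (modc a == 0) = (a == 0).
Proof.
by apply/eqP/eqP => [/(@nrm0_eq0 R R[i]^o)//|->]; exact: modc0.
Qed.

Lemma modc_gt0 a : (0 < modc a) = (a != 0).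
Proof. by rewrite lt_neqAle modc_ge0 andbT eq_sym modc_eq0. Qed.

Lemma modci : modc ('i%C : R[i]) = 1.
Proof. by rewrite /modc normc_def /= expr0n/= add0r expr1n sqrtr1. Qed.

Lemma ler_modc_add a : modc a <= `|complex.Re a| + `|complex.Im a|.
Proof.
rewrite {1}(complexE a) (le_trans (modcD _ _))// modcM !modc_real lerD2l.
by rewrite modci mul1r.
Qed.

Lemma ler_Re_modc a : `|complex.Re a| <= modc a.
Proof. by rewrite -lecR -modcC normc_ge_Re. Qed.

Lemma ler_Im_modc a : `|complex.Im a| <= modc a.
Proof.
rewrite -[modc a]mul1r -modci -modcM mulrC (le_trans _ (ler_Re_modc _))//.
by rewrite ReiNIm normrN.
Qed.

Lemma nrmZr (Y : normedModType R[i]) r (x : Y) : nrm (r%:C *: x) = `|r| * nrm x.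
Proof. by rewrite nrmZ modc_real. Qed.

End Modulus.

(** * Bounded operators and Frechet derivatives *)

Section BoundedOps.
Variables (R : realType) (X Y : normedModType R[i]).
Implicit Types (L : bounded_operator X Y).

Lemma nrm_opnorm L : nrm L = opnorm L.
Proof. by rewrite /nrm bounded_operator_normE. Qed.

Lemma nrm_app L x : nrm (L x) <= nrm L * nrm x.
Proof. by rewrite nrm_opnorm -lecR rmorphM /= -!nrmC opnorm_ub. Qed.

Lemma nrm_op_le L (c : R) :
  0 <= c -> (forall x, nrm (L x) <= c * nrm x) -> nrm L <= c.
Proof.
move=> c0 Lc; rewrite nrm_opnorm; apply: opnorm_le => // x.
by rewrite !nrmC -rmorphM lecR Lc.
Qed.

Lemma mk_bounded_operator (f : X -> Y) (c : R) : linear f ->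
  (forall x, nrm (f x) <= c * nrm x) ->
  exists L : bounded_operator X Y, L = f :> (X -> Y).
Proof.
move=> lf fc.
pose fl : {linear X -> Y} := HB.pack f (GRing.isLinear.Build _ _ _ _ f lf).
suff cf : continuous f.
  have Hf : f \in @bounded_linear_pred R X Y by apply/asboolP.
  by exists (BoundedOperator Hf).
apply: (@bounded_linear_continuous _ _ _ fl).
apply/linear_boundedP; near=> r => x.
rewrite !nrmC; apply: (@le_trans _ _ (c%:C * (nrm x)%:C)).
  by rewrite -rmorphM lecR fc.
rewrite ler_wpM2r ?ler0c ?nrm_ge0//.
near: r; apply: nbhs_pinfty_ge; by apply/complex_realP; exists c.
Unshelve. all: end_near. Qed.

Lemma addopE L1 L2 x : (L1 + L2) x = L1 x + L2 x. Proof. by []. Qed.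
Lemma oppopE L x : (- L) x = - L x. Proof. by []. Qed.
Lemma scaleopE a L x : (a *: L) x = a *: L x. Proof. by []. Qed.

Lemma opD L x y : L (x + y) = L x + L y. Proof. exact: linearD. Qed.
Lemma opZ L (c : R[i]) x : L (c *: x) = c *: L x. Proof. exact: linearZ. Qed.
Lemma opP L (c : R[i]) x y : L (c *: x + y) = c *: L x + L y.
Proof. exact: linearP. Qed.

(** Differentiability with real epsilons and with the derivative as an explicit operator: a
    derivative is computed by exhibiting [L], and [fder_differentiable] then identifies it with
    [frechetD]. *)
Definition fder (f : X -> Y) (x : X) (L : bounded_operator X Y) :=
  forall e : R, 0 < e -> exists2 d : R, 0 < d &
    forall v, nrm v < d -> nrm (f (x + v) - f x - L v) <= e * nrm v.

Lemma differentiable_fder f x : differentiable f x -> fder f x (frechetD f x).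
Proof.
move=> df e e0; have := df => /diff_locallyP[_ /eqaddoP/(_ e%:C)].
rewrite ltcR => /(_ e0)/nbhs0_nrm[d d0 H]; exists d => // v /H.
rewrite !fctE /= frechetDE// !nrmC -rmorphM lecR /=.
by rewrite [v + x]addrC opprD addrA.
Qed.

Lemma fder_differentiable f x L :
  fder f x L -> differentiable f x /\ frechetD f x = L.
Proof.
move=> fL.
have H : f \o shift x = cst (f x) + (L : X -> Y) +o_ 0 id.
  apply/eqaddoP => e e0; have eE : (complex.Re e)%:C = e by rewrite RRe_real// gtr0_real.
  have /fL[d d0 dP] : 0 < complex.Re e by rewrite -ltcR eE.
  apply/nbhs0_nrm; exists d => // v /dP; rewrite !fctE /= -{2}eE !nrmC -rmorphM lecR.
  by rewrite [v + x]addrC opprD addrA.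
have cL := @bounded_operator_continuous _ _ _ L.
have dE : 'd f x = L :> (X -> Y) by apply: diff_unique.
have df : differentiable f x.
  by apply/diff_locallyP; rewrite dE.
by split => //; apply/val_inj; rewrite /= frechetDE.
Qed.

End BoundedOps.

(** * Mean value inequality *)

(** The supremum of the [c] such that [f] is nonnegative on [[0, c]] is attained by the left-hand
    condition, and cannot be smaller than [T] by the right-hand one. Barrier arguments become
    instances with [f] the barrier minus the quantity to be bounded. *)
Lemma real_induction (R : realType) (T : R) (f : R -> R) : 0 <= f 0 ->
  (forall t, 0 <= t <= T -> 0 <= f t ->
    exists2 d, 0 < d & forall s, t < s < t + d -> s <= T -> 0 <= f s) ->
  (forall t, 0 <= t <= T -> forall e, 0 < e ->
    exists2 d, 0 < d & forall s, t - d < s <= t -> 0 <= s -> f s <= f t + e) ->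
  forall t, 0 <= t <= T -> 0 <= f t.
Proof.
move=> f0 fwd bwd t /andP[t0 tT].
pose A := [set c | 0 <= c <= T /\ forall s, 0 <= s <= c -> 0 <= f s].
have T0 : 0 <= T by lra.
have A0 : A 0.
  by split=> [|s s0]; [rewrite lexx|have -> : s = 0 by apply/eqP; rewrite eq_le andbC].
have supA : has_sup A by split; [exists 0|exists T => c -[/andP[]]].
set c := sup A.
have c0 : 0 <= c by apply: sup_upper_bound.
have cT : c <= T by apply: ge_sup; [exists 0|move=> x [/andP[]]].
have below s : 0 <= s < c -> 0 <= f s.
  move=> /andP[s0 sc]; have cs : 0 < c - s by rewrite subr_gt0.
  have [x [x0T Ax] sx] := sup_adherent cs supA.
  by apply: Ax; rewrite s0 ltW//; move: sx; rewrite -/c opprB addrC subrK.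
have fc : 0 <= f c.
  have [->//|cn0] := eqVneq c 0.
  have c_gt0 : 0 < c by rewrite lt_neqAle eq_sym cn0.
  rewrite leNgt; apply/negP => fc0.
  (* With this slack, [f s <= f c / 2 < 0] just to the left of [c], against [below]. *)
  have [||d d0 dP] := bwd c _ (- f c / 2) _; [by rewrite c0|by lra|].
  pose s := Num.max 0 (c - d / 2).
  have s0 : 0 <= s by rewrite le_max lexx.
  have sc : s < c by rewrite gt_max c_gt0/=; lra.
  have ds : c - d < s by rewrite lt_max; apply/orP; right; lra.
  have := dP s; rewrite ds (ltW sc) => /(_ isT s0).
  by have := below s; rewrite s0 sc => /(_ isT); lra.
have Ac : A c.
  split=> [|s /andP[s0]]; first by rewrite c0.
  by rewrite le_eqVlt => /predU1P[->//|sc]; apply: below; rewrite s0.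
have [cT'|] := ltP c T; last first.
  by move=> Tc; apply: Ac.2; lra.
have [|d d0 dP] := fwd c _ fc; first by rewrite c0.
pose s := Num.min T (c + d / 2).
have cs : c < s by rewrite lt_min cT'; lra.
have sd : s < c + d by rewrite gt_min; apply/orP; right; lra.
have sT : s <= T by rewrite ge_min lexx.
suff As : A s by have := sup_upper_bound supA As; rewrite -/c; lra.
split=> [|r /andP[r0 rs]]; first by lra.
have [rc|cr] := leP r c; first by apply: Ac.2; rewrite r0.
by apply: dP; [rewrite cr|]; lra.
Qed.

(** The slope [l + e] of the barrier strictly exceeds [l], so the local bound at [t] carries the
    inequality past [t]; [e] is removed at the end. *)
Lemma mean_value_le (R : realType) (Y : normedModType R[i]) (phi : R -> Y) (l : R) :
  0 <= l ->
  (forall t, 0 <= t <= 1 -> forall e, 0 < e -> exists2 d, 0 < d &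
    forall s, `|s - t| < d -> nrm (phi s - phi t) <= (l + e) * `|s - t|) ->
  nrm (phi 1 - phi 0) <= l.
Proof.
move=> l0 H; apply/ler_addgt0Pr => e e0.
suff : 0 <= (l + e) * 1 - nrm (phi 1 - phi 0) by lra.
have le0 : 0 < l + e by lra.
apply: (@real_induction _ 1 (fun t => (l + e) * t - nrm (phi t - phi 0))).
- by rewrite subrr nrm0; lra.
- move=> t t01 ft; have [d d0 dP] := H t t01 e e0.
  exists d => // s /andP[ts sd] _.
  have := dP s; rewrite gtr0_norm; last by lra.
  move=> /(_ ltac:(lra)).
  by have := nrm_tri (phi s) (phi t) (phi 0); lra.
- move=> t t01 r r0; have [d d0 dP] := H t t01 e e0.
  exists (Num.min d (r / (l + e))); first by rewrite lt_min d0 divr_gt0.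
  move=> s /andP[ts st] _.
  have ds : t - s < d by move: ts; rewrite ltrBlDr -ltrBlDl lt_min => /andP[].
  have rs : (t - s) * (l + e) <= r.
    by rewrite -ler_pdivlMr// ltW//; move: ts; rewrite ltrBlDr -ltrBlDl lt_min => /andP[].
  have := dP s; rewrite distrC ger0_norm; last by lra.
  move=> /(_ ds); have := nrm_tri (phi t) (phi s) (phi 0).
  rewrite (nrmB (phi t) (phi s)); nra.
- by rewrite ler01 lexx.
Qed.

(** * Linear identities *)

(* Reflection of linear identities in a left module to identities between the
   coefficients of the atoms. *)
Inductive lin_expr (K : Type) :=
| LinVar of nat | LinZero | LinAdd of lin_expr K & lin_expr K
| LinOpp of lin_expr K | LinScale of K & lin_expr K.
Arguments LinVar {K}.
Arguments LinZero {K}.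

Section LinExpr.
Variables (K : pzRingType) (V : lmodType K).
Implicit Types (e : lin_expr K) (env : seq V).

Fixpoint lin_eval env e : V :=
  match e with
  | LinVar n => nth 0 env n
  | LinZero => 0
  | LinAdd e1 e2 => lin_eval env e1 + lin_eval env e2
  | LinOpp e1 => - lin_eval env e1
  | LinScale c e1 => c *: lin_eval env e1
  end.

Fixpoint lin_coef e (i : nat) : K :=
  match e with
  | LinVar n => if Nat.eqb n i then 1 else 0
  | LinZero => 0
  | LinAdd e1 e2 => lin_coef e1 i + lin_coef e2 i
  | LinOpp e1 => - lin_coef e1 i
  | LinScale c e1 => c * lin_coef e1 i
  end.

Fixpoint lin_bounded (n : nat) e : bool :=
  match e with
  | LinVar m => m < n
  | LinZero => true
  | LinAdd e1 e2 => lin_bounded n e1 && lin_bounded n e2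
  | LinOpp e1 => lin_bounded n e1
  | LinScale _ e1 => lin_bounded n e1
  end%N.

Lemma lin_evalE env e : lin_bounded (size env) e ->
  lin_eval env e = \sum_(i < size env) lin_coef e i *: nth 0 env i.
Proof.
elim: e => [n|_|e1 IH1 e2 IH2|e1 IH1|c e1 IH1] /=.
- move=> ns; rewrite (bigD1 (Ordinal ns))//= PeanoNat.Nat.eqb_refl scale1r.
  rewrite big1 ?addr0// => i /eqP ni; case: (PeanoNat.Nat.eqb_spec n i) => [E|_].
    by case: ni; apply/val_inj.
  by rewrite scale0r.
- by rewrite big1// => i _; rewrite scale0r.
- move=> /andP[/IH1 -> /IH2 ->]; rewrite -big_split/=.
  by apply: eq_bigr => i _; rewrite scalerDl.
- by move=> /IH1 ->; rewrite -sumrN; apply: eq_bigr => i _; rewrite scaleNr.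
- move=> /IH1 ->; rewrite scaler_sumr; apply: eq_bigr => i _.
  by rewrite scalerA.
Qed.

Fixpoint lin_coef_eq (n : nat) e1 e2 : Prop :=
  if n is n'.+1 then lin_coef e1 n' = lin_coef e2 n' /\ lin_coef_eq n' e1 e2
  else True.

Lemma lin_eval_eq env e1 e2 :
  lin_bounded (size env) e1 && lin_bounded (size env) e2 ->
  lin_coef_eq (size env) e1 e2 -> lin_eval env e1 = lin_eval env e2.
Proof.
move=> /andP[b1 b2] H; rewrite !lin_evalE//; apply: eq_bigr => -[i /= il] _.
congr (_ *: _); move: H il; elim: (size env) => //= n IH [E /IH{}IH].
by rewrite ltnS leq_eqVlt => /predU1P[->|].
Qed.

End LinExpr.

(* Atoms are compared up to conversion: structure instances may differ
   syntactically. *)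
Ltac lin_same x y := first [constr_eq x y | unify x y].

Ltac lin_index x env :=
  match env with
  | ?y :: _ => let _ := match goal with _ => lin_same x y end in constr:(O)
  | _ :: ?env' => let n := lin_index x env' in constr:(S n)
  end.

Ltac lin_mem x env :=
  match env with
  | nil => constr:(false)
  | ?y :: _ => let _ := match goal with _ => lin_same x y end in constr:(true)
  | _ :: ?env' => lin_mem x env'
  end.

Ltac lin_atoms t env :=
  lazymatch t with
  | (?a + ?b)%R => let env' := lin_atoms a env in lin_atoms b env'
  | (- ?a)%R => lin_atoms a env
  | (_ *: ?a)%R => lin_atoms a env
  | 0%R => env
  | _ => lazymatch lin_mem t env with
         | true => env
         | false => constr:(t :: env)
         end
  end.

Ltac lin_reify K t env :=
  lazymatch t with
  | (?a + ?b)%R =>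
      let a' := lin_reify K a env in let b' := lin_reify K b env in
      constr:(@LinAdd K a' b')
  | (- ?a)%R => let a' := lin_reify K a env in constr:(@LinOpp K a')
  | (?c *: ?a)%R => let a' := lin_reify K a env in constr:(@LinScale K c a')
  | 0%R => constr:(@LinZero K)
  | _ => let n := lin_index t env in constr:(@LinVar K n)
  end.

Ltac lin_split :=
  repeat match goal with |- _ /\ _ => split | |- True => exact I end;
  cbn [lin_coef Nat.eqb].

(** The remaining goals are identities in [R[i]], one per atom, for [ring] or [field]; the scalars
    are read off the [realType] in the context. *)
Ltac linear_identity :=
  match goal with
  | |- ?l = ?r :> ?V =>
      let env := lin_atoms l (@nil V) in
      let env := lin_atoms r env in
      match type of V with _ =>
      let K := lazymatch goal with R : realType |- _ => constr:((R[i])%type) end in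
      let l' := lin_reify K l env in
      let r' := lin_reify K r env in
      apply: (@lin_eval_eq _ _ env l' r' isT); cbn [size lin_coef_eq]; lin_split
      end
  end.

(** * Goursat's theorem for midpoint sums *)

Lemma half_pow_small (R : realType) (c d : R) : 0 < d ->
  exists m, c * 2^-1 ^+ m < d.
Proof.
move=> d0; have [c0|c0] := leP c 0.
  by exists 0%N; rewrite expr0 mulr1 (le_lt_trans c0).
have := archi_boundP (ltW (divr_gt0 c0 d0)).
set m := Num.bound _ => cm; exists m.
rewrite exprVn ltr_pdivrMr ?exprn_gt0// mulrC -ltr_pdivrMr//.
by rewrite (lt_trans cm)// -natrX ltr_nat ltn_expl.
Qed.

(** With [e m = 2 D / 2^m] the intervals [[x m - e m, x m + e m]] are nested, since the radius
    shrinks by exactly the [D / 2^m] that the centre may move. The limit is the supremum of the left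
    ends. *)
Lemma geometric_cvg_real (R : realType) (x : nat -> R) (D : R) :
  (forall m, `|x m.+1 - x m| <= D * 2^-1 ^+ m) ->
  exists l, forall m, `|x m - l| <= 2 * D * 2^-1 ^+ m.
Proof.
move=> xD; pose e m : R := 2 * D * 2^-1 ^+ m.
have eS m : e m.+1 = e m / 2 by rewrite /e exprS; field.
have step m : x m - e m <= x m.+1 - e m.+1 /\ x m.+1 + e m.+1 <= x m + e m.
  by have := xD m; rewrite eS /e ler_norml; lra.
have lo m n : (m <= n)%N -> x m - e m <= x n - e n.
  by move=> /subnK <-; elim: (n - m)%N => //= k IH; rewrite addSn (le_trans IH)// (step _).1.
have hi m n : (m <= n)%N -> x n + e n <= x m + e m.
  by move=> /subnK <-; elim: (n - m)%N => //= k IH; rewrite addSn (le_trans _ IH)// (step _).2.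
have e0 m : 0 <= e m by have := xD m; have := normr_ge0 (x m.+1 - x m); rewrite /e; lra.
have lohi m n : x m - e m <= x n + e n.
  have := lo m (maxn m n) (leq_maxl _ _); have := hi n (maxn m n) (leq_maxr _ _).
  by have := e0 (maxn m n); lra.
pose A := [set x m - e m | m in [set: nat]].
have supA : has_sup A.
  by split; [exists (x 0%N - e 0%N), 0%N|exists (x 0%N + e 0%N) => _ [m _ <-]].
exists (sup A) => m; rewrite ler_norml; apply/andP; split.
  suff : sup A <= x m + e m by rewrite /e; lra.
  by apply: ge_sup; [case: supA|move=> _ [n _ <-]].
suff : x m - e m <= sup A by rewrite /e; lra.
by apply: sup_upper_bound => //; exists m.
Qed.

Lemma geometric_cvg_complex (R : realType) (x : nat -> R[i]) (D : R) :
  (forall m, modc (x m.+1 - x m) <= D * 2^-1 ^+ m) ->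
  exists l, forall m, modc (x m - l) <= 4 * D * 2^-1 ^+ m.
Proof.
move=> xD.
have [|l1 l1P] := @geometric_cvg_real R (fun m => complex.Re (x m)) D.
  by move=> m; rewrite -raddfB (le_trans _ (xD m))// ler_Re_modc.
have [|l2 l2P] := @geometric_cvg_real R (fun m => complex.Im (x m)) D.
  by move=> m; rewrite -raddfB (le_trans _ (xD m))// ler_Im_modc.
exists (Complex l1 l2) => m; rewrite (le_trans (ler_modc_add _))//.
rewrite !raddfB /= (le_trans (lerD (l1P m) (l2P m)))// -!mulrDl.
by have -> : 2 + 2 = 4 :> R by ring.
Qed.

Section MidpointSums.
Variables (R : realType) (Y : normedModType R[i]).
Implicit Types (k : R[i] -> Y) (K : set R[i]) (a b c : R[i]).

(* Midpoint Riemann sums over the dyadic subdivisions of the segment [a, b].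
   Cauchy's theorem is stated as the vanishing of such sums along triangles, so
   no integral, and no completeness of [Y], is needed. *)
Fixpoint msum k n a b : Y :=
  if n is n'.+1 then msum k n' a ((a + b) / 2) + msum k n' ((a + b) / 2) b
  else (b - a) *: k ((a + b) / 2).

Lemma msum_rev k n a b : msum k n b a = - msum k n a b.
Proof.
elim: n a b => [|n IH] a b /=; rewrite [b + a]addrC.
  by rewrite -opprB scaleNr.
rewrite (IH ((a + b) / 2) b) (IH a); linear_identity; ring.
Qed.

Lemma msumB k1 k2 n a b :
  msum (fun z => k1 z - k2 z) n a b = msum k1 n a b - msum k2 n a b.
Proof.
elim: n a b => [|n IH] a b /=; first by rewrite scalerBr.
by rewrite !IH opprD addrACA.
Qed.

Lemma msum_rot k n (w : R[i]) a b :
  msum k n (w * a) (w * b) = msum (fun z => w *: k (w * z)) n a b.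
Proof.
have mw : forall a b, (w * a + w * b) / 2 = w * ((a + b) / 2).
  by move=> ? ?; rewrite -mulrDr mulrA.
elim: n a b => [|n IH] a b /=; rewrite mw; last by rewrite !IH.
by rewrite -mulrBr scalerA mulrC.
Qed.

(** Reduces sums with values on the line of [y] to scalar ones; the scalar recursion is abstracted
    as [s], to be instantiated by [inv_sum]. *)
Lemma msum_scale (f : R[i] -> R[i]^o) (y : Y) n a b (s : nat -> R[i] -> R[i] -> R[i]) :
  (forall a b, s 0%N a b = (b - a) * f ((a + b) / 2)) ->
  (forall n a b, s n.+1 a b = s n a ((a + b) / 2) + s n ((a + b) / 2) b) ->
  msum (fun z => f z *: y) n a b = s n a b *: y.
Proof.
move=> s0 sS; elim: n a b => [|n IH] a b /=; first by rewrite scalerA s0.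
by rewrite !IH sS scalerDl.
Qed.

(** The midpoint rule is exact on affine functions. The right-hand side is a difference of values of
    a primitive, hence cancels around a triangle. *)
Lemma msum_affine (y0 y1 : Y) (z0 : R[i]) n a b :
  msum (fun z => y0 + (z - z0) *: y1) n a b
  = (b - a) *: y0 + (((b - z0) ^+ 2 - (a - z0) ^+ 2) / 2) *: y1.
Proof.
by elim: n a b => [|n IH] a b /=; rewrite ?IH; linear_identity; field.
Qed.

(** The sums only visit dyadic points of the segment, so closure of [K] under midpoints keeps every
    node in [K]. *)
Lemma msum_le k K (M : R) n a b :
  (forall x y, K x -> K y -> K ((x + y) / 2)) ->
  (forall z, K z -> nrm (k z) <= M) -> K a -> K b ->
  nrm (msum k n a b) <= modc (b - a) * M.
Proof.
move=> Kmid kM; elim: n a b => [|n IH] a b Ka Kb /=.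
  by rewrite nrmZ ler_wpM2l ?modc_ge0// kM//; exact: Kmid.
have Km := Kmid _ _ Ka Kb.
rewrite (le_trans (nrmD _ _))// (le_trans (lerD (IH _ _ Ka Km) (IH _ _ Km Kb)))//.
have half : modc (2^-1 : R[i]) = 2^-1.
  have -> : (2^-1 : R[i]) = (2^-1 : R)%:C by rewrite fmorphV rmorph_nat.
  by rewrite modc_real ger0_norm// invr_ge0.
have -> : (a + b) / 2 - a = (b - a) * 2^-1 by field.
have -> : b - (a + b) / 2 = (b - a) * 2^-1 by field.
by rewrite modcM half; lra.
Qed.

Definition triangle_sum k n a b c := msum k n a b + msum k n b c + msum k n c a.

(** The inner edges cancel by [msum_rev]. The subdivision consumes one level: [n.+1] for the large
    triangle, [n] for the four small ones. *)
Lemma triangle_sum_split k n a b c :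
  let p := (a + b) / 2 in let q := (b + c) / 2 in let r := (c + a) / 2 in
  triangle_sum k n.+1 a b c =
  triangle_sum k n a p r + triangle_sum k n p b q
  + triangle_sum k n r q c + triangle_sum k n p q r.
Proof.
move=> p q r; rewrite /triangle_sum /= -/p -/q -/r.
rewrite (msum_rev k n p r) (msum_rev k n p q) (msum_rev k n q r).
set ap := msum k n a p; set pb := msum k n p b; set bq := msum k n b q.
set qc := msum k n q c; set cr := msum k n c r; set ra := msum k n r a.
set pr := msum k n p r; set pq := msum k n p q; set qr := msum k n q r.
by linear_identity; ring.
Qed.

Definition cder (k : R[i] -> Y) (z : R[i]) (l : Y) := forall e : R, 0 < e ->
  exists2 d : R, 0 < d & forall w, modc (w - z) < d ->
    nrm (k w - k z - (w - z) *: l) <= e * modc (w - z).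

End MidpointSums.

Section Goursat.
Variables (R : realType) (Y : normedModType R[i]).
Variables (k : R[i] -> Y) (K : set R[i]).
Hypothesis Kmid : forall x y, K x -> K y -> K ((x + y) / 2).
Hypothesis Kclosed : forall l : R[i],
  (forall e : R, 0 < e -> exists2 x, K x & modc (x - l) < e) -> K l.
Hypothesis kder : forall z, K z -> exists l, cder k z l.

Definition small_triangle (d : R) (T : R[i] * R[i] * R[i]) :=
  let: (a, b, c) := T in [/\ K a, K b, K c &
  [/\ modc (a - b) <= d, modc (b - c) <= d & modc (c - a) <= d]].

(** The sum must be large at arbitrarily fine levels, because each passage to a subtriangle uses up
    one level. *)
Definition bad_triangle (e : R) (T : R[i] * R[i] * R[i]) :=
  let: (a, b, c) := T in
  forall N, exists2 n, (N <= n)%N & e < nrm (triangle_sum k n a b c).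

Lemma modc_half (a : R[i]) : modc (a / 2) = modc a / 2.
Proof.
rewrite modcM modcV; congr (_ / _).
by rewrite (_ : 2 = (2 : R)%:C) ?modc_real ?normr_nat// rmorph_nat.
Qed.

(** If all four children had sums at most [e / 4] from some level on, the parent would have sums at
    most [e] from the next level on. The bound on the first vertices makes them a geometric Cauchy
    sequence along a chain of children. *)
Lemma bad_triangle_child (d e : R) T : small_triangle d T -> bad_triangle e T ->
  exists2 T', small_triangle (d / 2) T' /\ bad_triangle (e / 4) T' &
    modc (T'.1.1 - T.1.1) <= d.
Proof.
case: T => -[a b] c [Ka Kb Kc [ab bc ca]] bad.
pose p := (a + b) / 2; pose q := (b + c) / 2; pose r := (c + a) / 2.
have [Kp Kq Kr] : [/\ K p, K q & K r] by split; exact: Kmid.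
have hm (x y : R[i]) : modc (x - y) <= d -> modc ((x - y) / 2) <= d / 2.
  by rewrite modc_half; lra.
have hm' (x y : R[i]) : modc (x - y) <= d -> modc ((y - x) / 2) <= d / 2.
  by rewrite modcB; exact: hm.
have E0 : [/\ a - p = (a - b) / 2, p - r = (b - c) / 2 & r - a = (c - a) / 2].
  by split; rewrite /p /r; field.
have E1 : [/\ p - b = (a - b) / 2, b - q = (b - c) / 2 & q - p = (c - a) / 2].
  by split; rewrite /p /q; field.
have E2 : [/\ r - q = (a - b) / 2, q - c = (b - c) / 2 & c - r = (c - a) / 2].
  by split; rewrite /r /q; field.
have E3 : [/\ p - q = (a - c) / 2, q - r = (b - a) / 2 & r - p = (c - b) / 2].
  by split; rewrite /r /q /p; field.
have d0 : 0 <= d by rewrite (le_trans _ ab)// modc_ge0.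
have s1 : small_triangle (d / 2) (a, p, r).
  by split => //; case: E0 => -> -> ->; split; exact: hm.
have s2 : small_triangle (d / 2) (p, b, q).
  by split => //; case: E1 => -> -> ->; split; exact: hm.
have s3 : small_triangle (d / 2) (r, q, c).
  by split => //; case: E2 => -> -> ->; split; exact: hm.
have s4 : small_triangle (d / 2) (p, q, r).
  by split => //; case: E3 => -> -> ->; split; exact: hm'.
have pa : modc (p - a) <= d.
  have -> : p - a = (b - a) / 2 by rewrite /p; field.
  by have := hm' _ _ ab; lra.
have ra : modc (r - a) <= d by case: E0 => _ _ ->; have := hm _ _ ca; lra.
apply: contrapT => nobad.
have good T : small_triangle (d / 2) T -> modc (T.1.1 - a) <= d ->
    exists N, forall n, (N <= n)%N ->
      nrm (triangle_sum k n T.1.1 T.1.2 T.2) <= e / 4.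
  move=> sT Ta; apply: contrapT => nT; apply: nobad; exists T => //; split=> //.
  case: T {sT Ta} nT => -[x y] z nT N; apply: contrapT => nN; apply: nT.
  exists N => n Nn; rewrite leNgt; apply/negP => en; apply: nN.
  by exists n.
have [|N1 H1] := good _ s1; first by rewrite /= subrr modc0.
have [//|N2 H2] := good _ s2.
have [//|N3 H3] := good _ s3.
have [//|N4 H4] := good _ s4.
pose N := maxn (maxn N1 N2) (maxn N3 N4).
(* The extra level pays for the subdivision: level [n.+1] of the parent is level [n >= N] of the
   children. *)
have [[//|n] Nn] := bad N.+1.
rewrite triangle_sum_split -/p -/q -/r => en.
have [] : [/\ (N1 <= n)%N, (N2 <= n)%N, (N3 <= n)%N & (N4 <= n)%N].
  by move: Nn; rewrite ltnS /N !geq_max => /andP[/andP[-> ->] /andP[-> ->]].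
move=> /H1/= h1 /H2/= h2 /H3/= h3 /H4/= h4.
move: en; apply/negP; rewrite -leNgt.
rewrite (le_trans (nrmD _ _))// (le_trans (lerD (nrmD _ _) h4))//.
rewrite (le_trans (lerD (lerD (nrmD _ _) h3) (lexx _)))//.
by move: h1 h2; set x := nrm _; set y := nrm _; lra.
Qed.

Lemma goursat a b c : K a -> K b -> K c -> forall e : R, 0 < e ->
  exists N, forall n, (N <= n)%N -> nrm (triangle_sum k n a b c) <= e.
Proof.
move=> Ka Kb Kc e e0; apply: contrapT => nN.
have bad0 : bad_triangle e (a, b, c).
  move=> N; apply: contrapT => nbad; apply: nN; exists N => n Nn.
  by rewrite leNgt; apply/negP => en; apply: nbad; exists n.
pose D := modc (a - b) + modc (b - c) + modc (c - a).
have [g1 g2 g3] := And3 (modc_ge0 (a - b)) (modc_ge0 (b - c)) (modc_ge0 (c - a)).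
have D0 : 0 <= D by rewrite !addr_ge0.
have small0 : small_triangle D (a, b, c) by split => //; split; rewrite /D; lra.
pose P m T := small_triangle (D * 2^-1 ^+ m) T /\ bad_triangle (e * 4^-1 ^+ m) T.
(* The default [T] of [xget] is never taken along the chain: [PS] supplies a child. *)
pose next m T := xget T [set T' | P m.+1 T' /\ modc (T'.1.1 - T.1.1) <= D * 2^-1 ^+ m].
pose T := fix T m := if m is m'.+1 then next m' (T m') else (a, b, c).
have PS m : P m (T m) -> P m.+1 (T m.+1) /\
    modc ((T m.+1).1.1 - (T m).1.1) <= D * 2^-1 ^+ m.
  move=> [sT bT]; have [T' [sT' bT'] TT'] := bad_triangle_child sT bT.
  rewrite /=; rewrite /next; case: xgetP => [? -> //|/(_ T')[]].
  by split => //; rewrite /P !exprSr !mulrA.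
have PT m : P m (T m).
  elim: m => [|m /PS[]//]; rewrite /P !expr0 !mulr1; split => //.
have [l lP] := geometric_cvg_complex (fun m => (PS m (PT m)).2).
have Kl : K l.
  apply: Kclosed => r r0; have [m mr] := half_pow_small (4 * D) r0.
  exists (T m).1.1; last by rewrite (le_lt_trans (lP m)).
  by have [] := PT m; case: (T m) => -[? ?] ? [].
have [v kv] := kder Kl.
(* Three edges of length at most [h], with integrand at most [e' (5 h)], give [15 e' h^2], where
   [h^2 = D^2 / 4^m]. This choice makes it at most half of [e / 4^m]; the [+ 1] covers [D = 0]. *)
pose e' := e / (30 * (D * D + 1)).
have DD : 0 < D * D + 1 by nra.
have e'0 : 0 < e' by rewrite divr_gt0// mulr_gt0.
have [d d0 dP] := kv e' e'0.
have [m md] := half_pow_small (5 * D) d0.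
pose h := D * 2^-1 ^+ m.
have h0 : 0 <= h by rewrite mulr_ge0// exprn_ge0// invr_ge0.
(* The first vertex is within [4 h] of the limit by [geometric_cvg_complex], and the other two
   within [h] of the first. *)
pose Kl' := [set z : R[i] | modc (z - l) <= 5 * h].
have Kl'mid x y : Kl' x -> Kl' y -> Kl' ((x + y) / 2).
  rewrite /Kl' /= => xl yl.
  have -> : (x + y) / 2 - l = ((x - l) + (y - l)) / 2 by field.
  by rewrite modc_half; have := modcD (x - l) (y - l); lra.
have kl z : Kl' z -> nrm (k z - (k l + (z - l) *: v)) <= e' * (5 * h).
  rewrite /Kl' /= => zl; rewrite opprD addrA.
  rewrite (le_trans (dP z _))// ?ler_pM2l//.
  by rewrite (le_lt_trans zl)// /h mulrA.
have [+ +] := PT m; have := lP m; rewrite -mulrA -/h.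
case: (T m) => -[a' b'] c' /= al [_ _ _ [ab bc ca]] /(_ 0%N)[n _].
have Ka' : Kl' a' by rewrite /Kl' /=; lra.
have Kb' : Kl' b'.
  rewrite /Kl' /=; have := modcD (b' - a') (a' - l).
  by rewrite subrKA (modcB b' a'); lra.
have Kc' : Kl' c'.
  by rewrite /Kl' /=; have := modcD (c' - a') (a' - l); rewrite subrKA; lra.
pose aff z := k l + (z - l) *: v.
have tE : triangle_sum k n a' b' c' = msum (fun z => k z - aff z) n a' b'
    + msum (fun z => k z - aff z) n b' c' + msum (fun z => k z - aff z) n c' a'.
  by rewrite !msumB !msum_affine /triangle_sum; linear_identity; field.
have ml x y : Kl' x -> Kl' y -> modc (x - y) <= h ->
    nrm (msum (fun z => k z - aff z) n x y) <= h * (e' * (5 * h)).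
  move=> Kx Ky xy; rewrite (le_trans (msum_le _ Kl'mid kl Kx Ky))//.
  by rewrite modcB ler_wpM2r// mulr_ge0 ?(ltW e'0)//; lra.
have := ml _ _ Ka' Kb' ab; have := ml _ _ Kb' Kc' bc; have := ml _ _ Kc' Ka' ca.
rewrite tE => i1 i2 i3; apply/negP; rewrite -leNgt.
rewrite (le_trans (nrmD _ _))// (le_trans (lerD (nrmD _ _) i1))//.
apply: (@le_trans _ _ (15 * (e' * h ^+ 2))); first by lra.
have -> : h ^+ 2 = D * D * 4^-1 ^+ m.
  rewrite /h exprMn -exprM mulnC exprM; congr (_ * _ ^+ m).
  by field.
have q0 : 0 <= (4^-1 : R) ^+ m by rewrite exprn_ge0// invr_ge0.
have -> : 15 * (e' * (D * D * 4^-1 ^+ m)) = e * 4^-1 ^+ m * (D * D / (2 * (D * D + 1))).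
  by rewrite /e'; field; rewrite gt_eqF.
rewrite ler_piMr ?mulr_ge0 ?(ltW e0)// ler_pdivrMr ?mulr_gt0//.
nra.
Qed.

End Goursat.

(** * The Cauchy estimate in one variable *)

Section CauchyEstimate.
Variables (R : realType) (Y : normedModType R[i]).
Implicit Types (k g : R[i] -> Y) (z w c : R[i]).

Lemma cder_comp_mul g c z (l : Y) : modc c = 1 -> cder g (c * z) l ->
  cder (fun w => g (c * w)) z (c *: l).
Proof.
move=> c1 gl e e0; have [d d0 dP] := gl e e0; exists d => // w wd.
have E : c * w - c * z = c * (w - z) by rewrite mulrBr.
have := dP (c * w); rewrite E modcM c1 mul1r => /(_ wd).
by rewrite scalerA [(w - z) * c]mulrC.
Qed.

Lemma cderD k g z (l l' : Y) : cder k z l -> cder g z l' ->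
  cder (fun w => k w + g w) z (l + l').
Proof.
move=> kl gl e e0; have e2 : 0 < e / 2 by lra.
have [d d0 dP] := kl _ e2; have [d' d'0 d'P] := gl _ e2.
exists (Num.min d d') => [|w]; first by rewrite lt_min d0.
rewrite lt_min => /andP[/dP h1 /d'P h2].
have -> : k w + g w - (k z + g z) - (w - z) *: (l + l')
    = (k w - k z - (w - z) *: l) + (g w - g z - (w - z) *: l').
  by linear_identity; ring.
by rewrite (le_trans (nrmD _ _))//; lra.
Qed.

Lemma cderZ k c z (l : Y) : cder k z l -> cder (fun w => c *: k w) z (c *: l).
Proof.
move=> kl e e0; have c0 : 0 < modc c + 1 by have := modc_ge0 c; lra.
have [d d0 dP] := kl _ (divr_gt0 e0 c0); exists d => // w /dP.
have -> : c *: k w - c *: k z - (w - z) *: (c *: l) = c *: (k w - k z - (w - z) *: l).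
  by linear_identity; ring.
rewrite nrmZ => H; rewrite (le_trans (ler_wpM2l (modc_ge0 c) H))//.
rewrite mulrA ler_wpM2r ?modc_ge0// mulrCA ler_piMr ?(ltW e0)//.
by rewrite ler_pdivrMr//; lra.
Qed.

Lemma cderV k z (l : Y) : z != 0 -> cder k z l ->
  exists l', cder (fun w => w^-1 *: k w) z l'.
Proof.
move=> z0 kl; exists (z^-1 *: l - z^-1 ^+ 2 *: k z) => e e0.
set r := modc z; have r0 : 0 < r by rewrite modc_gt0.
(* [A] bounds the coefficient of [modc (w - z) ^+ 2] in the last two terms of the remainder, once
   [modc w >= r / 2]. *)
pose A := 2 / r ^+ 2 * nrm l + 2 / r ^+ 3 * nrm (k z).
have A0 : 0 <= A by rewrite addr_ge0// mulr_ge0 ?nrm_ge0// divr_ge0// exprn_ge0// ltW.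
have [|d d0 dP] := kl (e * r / 4); first by rewrite divr_gt0 ?mulr_gt0.
exists (Num.min d (Num.min (r / 2) (e / (2 * (A + 1))))).
  by rewrite !lt_min d0 !divr_gt0//; lra.
move=> w; rewrite !lt_min => /and3P[/dP wd wr we].
set h := modc (w - z) in wd wr we *.
have h0 : 0 <= h := modc_ge0 _.
have rw : r / 2 <= modc w.
  by have := modc_sub_le w (w - z); rewrite opprB addrC subrK -/r -/h; lra.
have w_gt0 : 0 < modc w by lra.
have w0 : w != 0 by rewrite -modc_gt0.
have -> : w^-1 *: k w - z^-1 *: k z - (w - z) *: (z^-1 *: l - z^-1 ^+ 2 *: k z)
   = w^-1 *: (k w - k z - (w - z) *: l) - ((w - z) ^+ 2 / (w * z)) *: l
     + ((w - z) ^+ 2 / (z ^+ 2 * w)) *: k z.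
  by linear_identity; field; rewrite ?z0 ?w0.
have wV : (modc w)^-1 <= 2 / r by rewrite -[2 / r]invf_div lef_pV2 ?posrE ?divr_gt0.
have hw : h * (modc w)^-1 <= h * (2 / r) by rewrite ler_wpM2l.
rewrite (le_trans (nrmD _ _))// (le_trans (lerD (nrm_sub_le _ _) (lexx _)))//.
have n1 : modc ((w - z) ^+ 2 / (w * z)) = h ^+ 2 / (modc w * r).
  by rewrite modcM modcV modcX [modc (w * z)]modcM.
have n2 : modc ((w - z) ^+ 2 / (z ^+ 2 * w)) = h ^+ 2 / (r ^+ 2 * modc w).
  by rewrite modcM modcV modcX [modc (z ^+ 2 * w)]modcM modcX.
rewrite !nrmZ n1 n2 modcV.
have b1 : (modc w)^-1 * nrm (k w - k z - (w - z) *: l) <= 2 / r * (e * r / 4 * h).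
  by rewrite ler_pM ?invr_ge0 ?modc_ge0 ?nrm_ge0.
have {}b1 : (modc w)^-1 * nrm (k w - k z - (w - z) *: l) <= e / 2 * h.
  rewrite (le_trans b1)//; have -> : e / 2 * h = 2 / r * (e * r / 4 * h) by field; rewrite gt_eqF.
  by [].
have b2 : h ^+ 2 / (modc w * r) * nrm l <= h ^+ 2 * (2 / r ^+ 2 * nrm l).
  rewrite mulrA ler_wpM2r ?nrm_ge0// invfM ler_wpM2l ?sqr_ge0//.
  have -> : 2 / r ^+ 2 = 2 / r * r^-1 by field; rewrite gt_eqF.
  by rewrite ler_wpM2r// invr_ge0 ltW.
have b3 : h ^+ 2 / (r ^+ 2 * modc w) * nrm (k z) <= h ^+ 2 * (2 / r ^+ 3 * nrm (k z)).
  rewrite mulrA ler_wpM2r ?nrm_ge0// invfM ler_wpM2l ?sqr_ge0//.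
  have -> : 2 / r ^+ 3 = (r ^+ 2)^-1 * (2 / r) by field; rewrite gt_eqF.
  by rewrite ler_wpM2l// invr_ge0 exprn_ge0// ltW.
have b4 : h * (A + 1) <= e / 2.
  have A1 : 0 < A + 1 by lra.
  rewrite -ler_pdivlMr// (le_trans (ltW we))// le_eqVlt; apply/orP; left; apply/eqP.
  by field; rewrite gt_eqF.
have {}b4 : h ^+ 2 * A <= e / 2 * h by nra.
rewrite /A in b4; lra.
Qed.

(* The contour: the vertical segment from [side r] to ['i * side r], whose four
   rotations form a square around [0]. *)
Definition side (r : R) : R[i] := Complex r (- r).

Lemma side_rot r : 'i%C * side r = Complex r r.
Proof. by apply/eqP; rewrite eq_complex /=; apply/andP; split; apply/eqP; ring. Qed.

(** A closed convex region which for [r > 0] stays away from the pole at 0, on which Goursat's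
    theorem applies to the integrand, and which contains the right side of the square. *)
Definition box (r s : R) : set R[i] := [set z | r <= complex.Re z /\ modc z <= s].

Lemma Re_half z : complex.Re (z / 2) = complex.Re z / 2.
Proof.
have -> : z / 2 = Complex (complex.Re z / 2) (complex.Im z / 2).
  case: z => x y /=; have -> : (2 : R[i])^-1 = ((2^-1 : R)%:C) by rewrite fmorphV rmorph_nat.
  by apply/eqP; rewrite eq_complex /=; apply/andP; split; apply/eqP; ring.
by [].
Qed.

Lemma box_mid r s x y : box r s x -> box r s y -> box r s ((x + y) / 2).
Proof.
move=> [x1 x2] [y1 y2]; split; first by rewrite Re_half raddfD /=; lra.
by rewrite modc_half; have := modcD x y; lra.
Qed.

Lemma box_closed r s l :
  (forall e : R, 0 < e -> exists2 x, box r s x & modc (x - l) < e) -> box r s l.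
Proof.
move=> H; split.
  apply/ler_addgt0Pr => e /H[x [rx _] xl].
  have := ler_Re_modc (x - l); rewrite raddfB /= ler_norml; lra.
apply/ler_addgt0Pr => e /H[x [_ xs] xl].
by have := modc_sub_le x (x - l); rewrite opprB addrC subrK; lra.
Qed.

Lemma box_side r s t : 0 <= t -> r <= t -> 2 * t <= s ->
  [/\ box r s (side t), box r s ('i%C * side t) & box r s ((side t + 'i%C * side t) / 2)].
Proof.
move=> t0 rt ts.
have h1 : box r s (side t).
  split => //=; rewrite (le_trans (ler_modc_add _))//= normrN ger0_norm//; lra.
have h2 : box r s ('i%C * side t).
  by rewrite side_rot; split => //=; rewrite (le_trans (ler_modc_add _))//= ger0_norm//; lra.
by split => //; exact: box_mid.
Qed.

(** The midpoint sums of [1 / z], in the form asked for by [msum_scale]. Along one side of the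
    square the integral is [i pi / 2]; the bound [1] of [inv_sum_side] is a crude form of this. *)
Fixpoint inv_sum n (a b : R[i]) : R[i] :=
  if n is n'.+1 then inv_sum n' a ((a + b) / 2) + inv_sum n' ((a + b) / 2) b
  else (b - a) * ((a + b) / 2)^-1.

Lemma inv_sum0 a b : inv_sum 0 a b = (b - a) * ((a + b) / 2)^-1.
Proof. by []. Qed.

Lemma inv_sumS n a b :
  inv_sum n.+1 a b = inv_sum n a ((a + b) / 2) + inv_sum n ((a + b) / 2) b.
Proof. by []. Qed.

(** A single term with midpoint [r + i m] has imaginary part [(v - u) r / (r^2 + m^2)], and
    [m^2 <= r^2]. The lower bound is additive in the segment, so it holds at every level. *)
Lemma inv_sum_ge n (r u v : R) : 0 < r -> - r <= u -> u <= v -> v <= r ->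
  (v - u) / (2 * r) <= complex.Im (inv_sum n (Complex r u) (Complex r v)).
Proof.
move=> r0; have midE (u' v' : R) : (Complex r u' + Complex r v') / 2 = Complex r ((u' + v') / 2).
  have -> : (2 : R[i])^-1 = ((2^-1 : R)%:C) by rewrite fmorphV rmorph_nat.
  by apply/eqP; rewrite eq_complex /=; apply/andP; split; apply/eqP; field.
elim: n u v => [|n IH] u v ru uv vr; rewrite ?inv_sum0 ?inv_sumS midE; last first.
  rewrite raddfD /=; have := IH u ((u + v) / 2); have := IH ((u + v) / 2) v.
  have -> : (v - u) / (2 * r) = (v - (u + v) / 2) / (2 * r) + ((u + v) / 2 - u) / (2 * r).
    by field; rewrite gt_eqF.
  by move=> h1 h2; rewrite addrC lerD//; [apply: h2|apply: h1]; lra.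
set m := (u + v) / 2.
have m2 : m ^+ 2 <= r ^+ 2 by rewrite /m; nra.
have -> : complex.Im ((Complex r v - Complex r u) * (Complex r m)^-1)
   = (v - u) * r / (r ^+ 2 + m ^+ 2) by rewrite /=; field; rewrite gt_eqF//; nra.
have p1 : 0 < r ^+ 2 + m ^+ 2 by nra.
rewrite -mulrA ler_wpM2l ?subr_ge0//.
by rewrite ler_pdivlMr// mulrC ler_pdivrMr ?mulr_gt0//; nra.
Qed.

Lemma inv_sum_side n r : 0 < r -> 1 <= modc (inv_sum n (side r) ('i%C * side r)).
Proof.
move=> r0; have := @inv_sum_ge n r (- r) r r0; rewrite side_rot => h.
have {}h : (r - - r) / (2 * r) <= complex.Im (inv_sum n (side r) (Complex r r)).
  by apply: h; lra.
rewrite (le_trans _ (le_trans (ler_norm _) (ler_Im_modc _)))// (le_trans _ h)//.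
by rewrite ler_pdivlMr ?mulr_gt0//; lra.
Qed.

End CauchyEstimate.

(** * Cauchy's estimate from one side of a square *)

Section CauchySquare.
Variables (R : realType) (Y : normedModType R[i]).
Variables (g : R[i] -> Y) (s M : R) (l : Y).
Hypothesis s0 : 0 < s.
Hypothesis gder : forall z, modc z <= 2 * s -> exists l', cder g z l'.
Hypothesis gM : forall z, modc z <= 2 * s -> nrm (g z) <= M.
Hypothesis gl : cder g 0 l.

(* Averaging over the rotations by 'i kills the constant term, so that the
   integrand below has no double pole and is invariant under rotation. *)
Let G (z : R[i]) : Y :=
  4^-1 *: (g (1 * z) - 'i%C *: g ('i%C * z) - g (-1 * z) + 'i%C *: g (- 'i%C * z)).
Let k (z : R[i]) : Y := z^-1 *: (z^-1 *: G z - l).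

Let i2 : 'i%C * 'i%C = -1 :> R[i]. Proof. by rewrite -expr2 sqr_i. Qed.
Let i_neq0 : 'i%C != 0 :> R[i]. Proof. by rewrite -modc_gt0 modci. Qed.

Let G_rot (z : R[i]) : G ('i%C * z) = 'i%C *: G z.
Proof.
rewrite /G; have -> : 1 * ('i%C * z) = 'i%C * z by rewrite mul1r.
have -> : 'i%C * ('i%C * z) = -1 * z by rewrite mulrA i2.
have -> : -1 * ('i%C * z) = - 'i%C * z by rewrite mulrA mulN1r.
have -> : - 'i%C * ('i%C * z) = 1 * z by rewrite mulrA mulNr i2 opprK.
by linear_identity; ring: i2.
Qed.

(** The form [k(z) dz] is invariant under the quarter turn, so the four sides of the square have
    equal sums and one side stands for the whole contour. *)
Let k_rot (z : R[i]) : 'i%C *: k ('i%C * z) = k z.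
Proof.
rewrite /k G_rot; have -> : ('i%C * z)^-1 *: ('i%C *: G z) = z^-1 *: G z.
  by rewrite scalerA invfM mulrAC mulVf// mul1r.
by rewrite scalerA invfM mulrA divff// mul1r.
Qed.

Let G0 : G 0 = 0.
Proof. by rewrite /G !mulr0; linear_identity; ring. Qed.

Let GE : G = fun w => 4^-1 *: (g (1 * w) + - 'i%C *: g ('i%C * w) + -1 *: g (-1 * w)
  + 'i%C *: g (- 'i%C * w)).
Proof. by apply/funext => w; rewrite /G; linear_identity; ring. Qed.

Let G_der z : modc z <= 2 * s -> exists l', cder G z l'.
Proof.
move=> zs; have H c : modc c = 1 -> exists l', cder (fun w => g (c * w)) z l'.
  move=> c1; have [|l' gl'] := gder (z := c * z); first by rewrite modcM c1 mul1r.
  by exists (c *: l'); exact: cder_comp_mul c1 gl'.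
have [|l1 h1] := H 1; first exact: modc1.
have [|l2 h2] := H 'i%C; first exact: modci.
have [|l3 h3] := H (-1); first by rewrite modcN modc1.
have [|l4 h4] := H (- 'i%C); first by rewrite modcN modci.
have h := cderZ 4^-1 (cderD (cderD (cderD h1 (cderZ (- 'i%C) h2)) (cderZ (-1) h3)) (cderZ 'i%C h4)).
by eexists; rewrite GE; exact: h.
Qed.

(** In the average each rotation [c] carries the factor [c^-1], which cancels the [c] of the chain
    rule: the mean of four copies of [l]. *)
Let G_der0 : cder G 0 l.
Proof.
have H c : modc c = 1 -> cder (fun w => g (c * w)) 0 (c *: l).
  move=> c1; have := gl; rewrite -{1}(mulr0 c); exact: cder_comp_mul c1.
have h1 := H 1 (modc1 R).
have h2 := H 'i%C (modci R).
have h3 : cder (fun w => g (-1 * w)) 0 (-1 *: l) by apply: H; rewrite modcN modc1.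
have h4 : cder (fun w => g (- 'i%C * w)) 0 (- 'i%C *: l) by apply: H; rewrite modcN modci.
have h := cderZ 4^-1 (cderD (cderD (cderD h1 (cderZ (- 'i%C) h2)) (cderZ (-1) h3)) (cderZ 'i%C h4)).
rewrite GE.
suff <- : 4^-1 *: (1 *: l + - 'i%C *: ('i%C *: l) + -1 *: (-1 *: l) + 'i%C *: (- 'i%C *: l)) = l.
  exact: h.
by linear_identity; field: i2.
Qed.

Let G_le z : modc z <= 2 * s -> nrm (G z) <= M.
Proof.
move=> zs; have H c : modc c = 1 -> nrm (g (c * z)) <= M.
  by move=> c1; apply: gM; rewrite modcM c1 mul1r.
have a1 := H 1 (modc1 R); have a2 := H 'i%C (modci R).
have a3 := H (-1); have a4 := H (- 'i%C).
rewrite modcN modc1 in a3; rewrite modcN modci in a4.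
move: (a3 erefl) (a4 erefl) => {}a3 {}a4.
rewrite /G nrmZ modcV.
have -> : modc (4 : R[i]) = 4.
  by rewrite (_ : 4 = (4 : R)%:C) ?modc_real ?normr_nat// rmorph_nat.
rewrite mulrC ler_pdivrMr//.
rewrite (le_trans (nrmD _ _))// nrmZ modci (mul1r (nrm _)).
rewrite (le_trans (lerD (nrm_sub_le _ _) (lexx _)))//.
rewrite (le_trans (lerD (lerD (nrm_sub_le _ _) (lexx _)) (lexx _)))//.
by rewrite nrmZ modci (mul1r (nrm _)); lra.
Qed.

Let box_neq0 (r t : R) z : 0 < r -> box r t z -> z != 0.
Proof. by move=> r0 [rz _]; apply: contraTneq rz => ->; rewrite /= -ltNge. Qed.

Let k_der (z : R[i]) : z != 0 -> modc z <= 2 * s -> exists l', cder k z l'.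
Proof.
move=> z0 zs; have [l1 h1] := G_der zs; have [l2 h2] := cderV z0 h1.
have cst : cder (fun _ : R[i] => - l) z 0.
  move=> e e0; exists 1 => // w _.
  by rewrite subrr scaler0 subr0 nrm0 mulr_ge0 ?modc_ge0// ltW.
exact: cderV z0 (cderD h2 cst).
Qed.

(** The trapezoid between the two sides is cut into three triangles meeting at the midpoint of the
    outer side, whence level [n.+1] there. Its slanted edges are rotations of each other and cancel
    by [k_rot]. *)
Let shift_square (r : R) : 0 < r -> r <= s -> forall e : R, 0 < e ->
  exists N, forall n, (N <= n)%N ->
    nrm (msum k n.+1 (side r) ('i%C * side r)
         - msum k n (side (r / 2)) ('i%C * side (r / 2))) <= e.
Proof.
move=> r0 rs e e0; set p := side r; set q := 'i%C * p.
set p' := side (r / 2); set q' := 'i%C * p'; pose m := (p + q) / 2.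
pose K : set R[i] := box (r / 2) (2 * s).
have [Kp Kq Km] : [/\ K p, K q & K m] by apply: box_side; lra.
have [Kp' Kq' _] : [/\ K p', K q' & K ((p' + q') / 2)] by apply: box_side; lra.
have Kder z : K z -> exists l', cder k z l'.
  move=> Kz; have [_ zs] := Kz; apply: k_der => //.
  by apply: (box_neq0 _ Kz); lra.
have e3 : 0 < e / 3 by lra.
have gs := goursat (@box_mid R (r / 2) (2 * s)) (@box_closed R (r / 2) (2 * s)) Kder.
have [N1 H1] := gs _ _ _ Kp' Kp Km _ e3.
have [N2 H2] := gs _ _ _ Kp' Km Kq' _ e3.
have [N3 H3] := gs _ _ _ Km Kq Kq' _ e3.
exists (maxn N1 (maxn N2 N3)) => n; rewrite !geq_max => /and3P[/H1 h1 /H2 h2 /H3 h3].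
have -> : msum k n.+1 p q - msum k n p' q' =
    triangle_sum k n p' p m + triangle_sum k n p' m q' + triangle_sum k n m q q'.
  rewrite /triangle_sum /= -/m (msum_rev k n p' m) (msum_rev k n m q').
  rewrite (msum_rev k n p' q') (msum_rev k n q' q) /q' /q msum_rot.
  have -> : (fun z => 'i%C *: k ('i%C * z)) = k by exact/funext/k_rot.
  by linear_identity; ring.
rewrite (le_trans (nrmD _ _))// (le_trans (lerD (nrmD _ _) h3))//.
by move: h1 h2; set x := nrm _; set y := nrm _; lra.
Qed.

Let side_len (r : R) : 0 < r -> modc ('i%C * side r - side r) = 2 * r.
Proof.
move=> r0; have -> : 'i%C * side r - side r = 'i%C * (2 * r)%:C.
  by rewrite side_rot; apply/eqP; rewrite eq_complex /=; apply/andP; split; apply/eqP; ring.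
by rewrite modcM modci mul1r modc_real ger0_norm//; lra.
Qed.

(** Since [G 0 = 0] and [l] is the derivative of [G] at 0, [k z] is at most [e / modc z] near 0,
    while the side has length [2 r]. *)
Let small_square (e : R) : 0 < e -> exists2 d : R, 0 < d &
  forall (r : R) n, 0 < r -> r < d -> r <= s ->
    nrm (msum k n (side r) ('i%C * side r)) <= 2 * e.
Proof.
move=> e0; have [d d0 dP] := G_der0 e0.
exists (d / 2) => [|r n r0 rd rs]; first by lra.
have [Kp Kq _] := box_side (ltW r0) (lexx r) (lexx (2 * r)).
have kle z : box r (2 * r) z -> nrm (k z) <= e / r.
  move=> Kz; have z0 := box_neq0 r0 Kz; case: Kz => rz zr.
  have rm : r <= modc z by have := ler_Re_modc z; have := ler_norm (complex.Re z); lra.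
  have -> : k z = z^-1 ^+ 2 *: (G z - G 0 - (z - 0) *: l).
    rewrite G0 /k; linear_identity; field; by rewrite ?z0.
  have zd : modc (z - 0) < d by rewrite subr0; lra.
  rewrite nrmZ modcX modcV (le_trans (ler_wpM2l _ (dP _ zd)))//.
    by rewrite exprn_ge0// invr_ge0 modc_ge0.
  have -> : (modc z)^-1 ^+ 2 * (e * modc (z - 0)) = e / modc z.
    by rewrite subr0; field; rewrite gt_eqF//; lra.
  by rewrite ler_wpM2l ?(ltW e0)// lef_pV2// posrE; lra.
rewrite (le_trans (msum_le _ (@box_mid R r (2 * r)) kle Kp Kq))// side_len//.
by have -> : 2 * r * (e / r) = 2 * e by field; rewrite gt_eqF.
Qed.

(** The side is halved until [small_square] applies. The tolerance [e'] is halved with it, so that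
    the shifts together cost at most [e'] whatever their number. *)
Let square_sum (r : R) : 0 < r -> r <= s -> forall e : R, 0 < e ->
  exists N, forall n, (N <= n)%N -> nrm (msum k n (side r) ('i%C * side r)) <= e.
Proof.
move=> r0 rs e e0; have e4 : 0 < e / 4 by lra.
have [d d0 dP] := small_square e4.
have [m md] := half_pow_small r d0.
suff H : forall m (r : R), 0 < r -> r <= s -> r * 2^-1 ^+ m < d -> forall e' : R, 0 < e' ->
    exists N, forall n, (N <= n)%N ->
      nrm (msum k n (side r) ('i%C * side r)) <= 2 * (e / 4) + e'.
  have [N HN] := H m r r0 rs md (e / 2) (divr_gt0 e0 (ltr0Sn _ _)).
  by exists N => n /HN; lra.
elim=> [|m' IH] r' r'0 r's.
  rewrite expr0 mulr1 => r'd e' e'0; exists 0%N => n _.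
  by have := dP r' n r'0 r'd r's; lra.
rewrite exprS => r'd e' e'0; have {}r'd : r' / 2 * 2^-1 ^+ m' < d by rewrite -mulrA.
have e2 : 0 < e' / 2 by lra.
have [||N1 H1] := IH _ _ _ r'd (e' / 2) e2; [by lra|by lra|].
have [N2 H2] := shift_square r'0 r's e2.
exists (maxn N1 N2).+1 => -[//|n]; rewrite ltnS geq_max => /andP[/H1 h1 /H2 h2].
by rewrite (le_trans (nrm_le_sub _ _) (le_trans (lerD h2 h1) _))//; lra.
Qed.

(** The sums of [k = G / z^2 - l / z] tend to 0. On the side, those of [l / z] have norm at least
    [nrm l], and those of [G / z^2] at most the length [2 s] times [M / s^2]. *)
Lemma cauchy_square_le : nrm l <= 2 * M / s.
Proof.
apply/ler_addgt0Pr => e e0; have [N HN] := square_sum s0 (lexx s) e0.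
have [Kp Kq _] := box_side (ltW s0) (lexx s) (lexx (2 * s)).
pose k1 z := z^-1 ^+ 2 *: G z; pose k2 z : Y := (z^-1 : R[i]^o) *: l.
have kE : k = fun z => k1 z - k2 z.
  by apply/funext => z; rewrite /k /k1 /k2; linear_identity; ring.
have M0 : 0 <= M by rewrite (le_trans (nrm_ge0 _) (@gM 0 _))// modc0 mulr_ge0// ltW.
have k1le z : box s (2 * s) z -> nrm (k1 z) <= M / s ^+ 2.
  move=> [sz zs]; have sm : s <= modc z.
    by have := ler_Re_modc z; have := ler_norm (complex.Re z); lra.
  rewrite /k1 nrmZ modcX modcV mulrC exprVn ler_pM ?nrm_ge0 ?G_le//.
    by rewrite invr_ge0 exprn_ge0 ?modc_ge0.
  by rewrite lef_pV2 ?posrE ?exprn_gt0// ?(lt_le_trans s0 sm)//; have := s0; nra.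
have := msum_le N (@box_mid R s (2 * s)) k1le Kp Kq; rewrite side_len//.
have -> : 2 * s * (M / s ^+ 2) = 2 * M / s by field; rewrite gt_eqF.
move=> h1; have := HN N (leqnn N); rewrite kE msumB => h2.
have h3 := le_trans (nrm_le_sub _ _) (lerD h2 (lexx _)).
have := nrm_tri (msum k2 N (side s) ('i%C * side s)) (msum k1 N (side s) ('i%C * side s)) 0.
rewrite !subr0 nrmB => h4.
have : nrm l <= nrm (msum k2 N (side s) ('i%C * side s)).
  rewrite (@msum_scale _ _ _ l N _ _ (@inv_sum R))// nrmZ.
  by rewrite ler_peMl ?nrm_ge0// inv_sum_side.
lra.
Qed.

End CauchySquare.

(** * Holomorphic maps between normed spaces *)

Section RealCurves.
Variables (R : realType) (Y : normedModType R[i]).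
Implicit Types (p : R -> Y) (t : R).

(** Derivative in a real parameter, which acts on [Y] through its embedding into [R[i]]. *)
Definition rder p t (l : Y) := forall e : R, 0 < e -> exists2 d : R, 0 < d &
  forall s, `|s - t| < d -> nrm (p s - p t - (s - t)%:C *: l) <= e * `|s - t|.

Lemma rderD p1 p2 t l1 l2 : rder p1 t l1 -> rder p2 t l2 ->
  rder (fun s => p1 s + p2 s) t (l1 + l2).
Proof.
move=> h1 h2 e e0; have e2 : 0 < e / 2 by lra.
have [d d0 dP] := h1 _ e2; have [d' d'0 d'P] := h2 _ e2.
exists (Num.min d d') => [|s]; first by rewrite lt_min d0.
rewrite lt_min => /andP[/dP H1 /d'P H2].
have -> : p1 s + p2 s - (p1 t + p2 t) - (s - t)%:C *: (l1 + l2)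
    = (p1 s - p1 t - (s - t)%:C *: l1) + (p2 s - p2 t - (s - t)%:C *: l2).
  by linear_identity; ring.
by rewrite (le_trans (nrmD _ _))//; lra.
Qed.

Lemma rder_scale (c : R -> R) t (c' : R) (y : Y) : is_derive t 1 c c' ->
  rder (fun s => (c s)%:C *: y) t (c'%:C *: y).
Proof.
move=> [dc Dc] e e0; have y0 : 0 < nrm y + 1 by have := nrm_ge0 y; lra.
have /derivable1_diffP dfc := dc.
have /diff_locallyx/eqaddoEx H := dfc.
have /diff_locallyP[_ /eqaddoP/(_ _ (divr_gt0 e0 y0))] := dfc.
move=> /nbhs_ballP[d /= d0 dP]; exists d => // s sd.
have := dP (s - t); rewrite -ball_normE /= sub0r normrN => /(_ sd).
rewrite !fctE /= subrK deriv1E// derive1E Dc => h.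
have -> : (c s)%:C *: y - (c t)%:C *: y - (s - t)%:C *: (c'%:C *: y)
    = (c s - (c t + (s - t) *: c'))%:C *: y.
  by rewrite opprD addrA !rmorphB /= rmorphM /= rmorphB /=; linear_identity; ring.
rewrite nrmZr (le_trans (ler_wpM2r (nrm_ge0 y) h))//.
rewrite mulrAC ler_wpM2r// mulrAC ler_pdivrMr// ler_pM2l//; lra.
Qed.

End RealCurves.

Section FrechetCalculus.
Variables (R : realType) (X Y : normedModType R[i]).
Implicit Types (f g : X -> Y) (L : bounded_operator X Y) (a x v : X).

Lemma fderD f g x L1 L2 : fder f x L1 -> fder g x L2 ->
  fder (fun y => f y + g y) x (L1 + L2).
Proof.
move=> fL gL e e0; have e2 : 0 < e / 2 by lra.
have [d d0 dP] := fL _ e2; have [d' d'0 d'P] := gL _ e2.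
exists (Num.min d d') => [|v]; first by rewrite lt_min d0.
rewrite lt_min => /andP[/dP h1 /d'P h2].
have -> : f (x + v) + g (x + v) - (f x + g x) - (L1 + L2) v
    = (f (x + v) - f x - L1 v) + (g (x + v) - g x - L2 v).
  by rewrite addopE; linear_identity; ring.
by rewrite (le_trans (nrmD _ _))//; lra.
Qed.

Lemma fderZ f (c : R[i]) x L : fder f x L -> fder (fun y => c *: f y) x (c *: L).
Proof.
move=> fL e e0; have c0 : 0 < modc c + 1 by have := modc_ge0 c; lra.
have [d d0 dP] := fL _ (divr_gt0 e0 c0); exists d => // v /dP.
have -> : c *: f (x + v) - c *: f x - (c *: L) v = c *: (f (x + v) - f x - L v).
  by rewrite scaleopE; linear_identity; ring.
rewrite nrmZ => H; rewrite (le_trans (ler_wpM2l (modc_ge0 c) H))//.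
rewrite mulrA ler_wpM2r ?nrm_ge0// mulrCA ler_piMr ?(ltW e0)//.
by rewrite ler_pdivrMr//; lra.
Qed.

Lemma fderB f g x L1 L2 : fder f x L1 -> fder g x L2 ->
  fder (fun y => f y - g y) x (L1 - L2).
Proof.
move=> fL gL; rewrite -scaleN1r (_ : (fun y => f y - g y) = fun y => f y + -1 *: g y).
  exact: fderD fL (fderZ _ gL).
by apply/funext => y; rewrite scaleN1r.
Qed.

Lemma fder_shift f v x L : fder f (x + v) L -> fder (fun y => f (y + v)) x L.
Proof.
move=> fL e /fL[d d0 dP]; exists d => // w /dP.
by rewrite (addrAC x w).
Qed.

(** [B] is an argument because [v |-> A v w] first has to be packed as a bounded operator. *)
Lemma fder_app (Z : normedModType R[i]) (F : X -> bounded_operator Z Y) x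
    (A : bounded_operator X (bounded_operator Z Y)) (w : Z) (B : bounded_operator X Y) :
  fder F x A -> (forall v, B v = A v w) -> fder (fun y => F y w) x B.
Proof.
move=> FA BA e e0; have w0 : 0 < nrm w + 1 by have := nrm_ge0 w; lra.
have [d d0 dP] := FA _ (divr_gt0 e0 w0); exists d => // v /dP H; rewrite BA.
have -> : F (x + v) w - F x w - A v w = (F (x + v) - F x - A v) w by [].
rewrite (le_trans (nrm_app _ _))// (le_trans (ler_wpM2r (nrm_ge0 _) H))//.
rewrite mulrAC ler_wpM2r ?nrm_ge0// mulrAC ler_pdivrMr//.
by rewrite ler_pM2l//; lra.
Qed.

Lemma fder_continuous f x L : fder f x L ->
  exists2 d, 0 < d & forall v, nrm v < d -> nrm (f (x + v)) <= nrm (f x) + (nrm L + 1) * d.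
Proof.
move=> fL; have [d d0 dP] := fL 1 ltr01; exists d => // v vd.
have := dP v vd; rewrite mul1r.
have := nrm_le_sub (f (x + v)) (f x); have := nrm_le_sub (f (x + v) - f x) (L v).
have := nrm_app L v; have := nrm_ge0 L; nra.
Qed.

Lemma fder_slice f x v z L : fder f (x + z *: v) L ->
  cder (fun w : R[i] => f (x + w *: v)) z (L v).
Proof.
move=> fL e e0; have v0 : 0 < nrm v + 1 by have := nrm_ge0 v; lra.
have [d d0 dP] := fL _ (divr_gt0 e0 v0); exists (d / (nrm v + 1)); first by rewrite divr_gt0.
move=> w; rewrite ltr_pdivlMr// => wd.
have nwv : nrm ((w - z) *: v) <= modc (w - z) * (nrm v + 1).
  by rewrite nrmZ ler_wpM2l ?modc_ge0//; lra.
have := dP _ (le_lt_trans nwv wd); rewrite linearZ /=.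
have -> : x + z *: v + (w - z) *: v = x + w *: v by linear_identity; ring.
move=> H; rewrite (le_trans H)// (le_trans (ler_wpM2l _ nwv))//.
  by rewrite divr_ge0// ltW.
by rewrite mulrCA divfK ?gt_eqF// mulrC.
Qed.

(** Mean value inequality for [f (t v) - p t]. With [p] a Taylor polynomial along the segment, it
    derives a remainder bound for [f] from one for its derivative. *)
Lemma curve_mean_value f v (p p' : R -> Y) (l : R) :
  0 <= l -> (forall t, rder p t (p' t)) ->
  (forall t : R, 0 <= t <= 1 -> exists2 L, fder f (t%:C *: v) L &
    nrm (L v - p' t) <= l) ->
  nrm (f v - f 0 - (p 1 - p 0)) <= l.
Proof.
move=> l0 pp' H; pose phi (t : R) := f (t%:C *: v) - p t.
have aux (x1 x2 x3 x4 : Y) : x1 - x2 - (x3 - x4) = x1 - x3 - (x2 - x4).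
  by linear_identity; ring.
have -> : f v - f 0 - (p 1 - p 0) = phi 1 - phi 0.
  rewrite /phi rmorph1 rmorph0 scale1r scale0r.
  exact: aux.
apply: mean_value_le => // t t01 e e0; have [L fL Ll] := H t t01.
have v0 : 0 < nrm v + 1 by have := nrm_ge0 v; lra.
have e20 : 0 < e / 2 by lra.
have [d d0 dP] := fL _ (divr_gt0 e20 v0).
have [d' d'0 d'P] := pp' t _ e20.
exists (Num.min d' (d / (nrm v + 1))); first by rewrite lt_min d'0 divr_gt0.
move=> s; rewrite lt_min ltr_pdivlMr// => /andP[/d'P h' sd].
have nsv : nrm ((s - t)%:C *: v) <= `|s - t| * (nrm v + 1).
  by rewrite nrmZr ler_wpM2l//; lra.
have := dP _ (le_lt_trans nsv sd); rewrite opZ.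
have -> : t%:C *: v + (s - t)%:C *: v = s%:C *: v.
  by rewrite rmorphB /=; linear_identity; ring.
move=> Hs.
have -> : phi s - phi t = (f (s%:C *: v) - f (t%:C *: v) - (s - t)%:C *: L v)
    + ((s - t)%:C *: (L v - p' t) + - (p s - p t - (s - t)%:C *: p' t)).
  by rewrite /phi rmorphB /=; linear_identity; ring.
have Hs' : nrm (f (s%:C *: v) - f (t%:C *: v) - (s - t)%:C *: L v) <= e / 2 * `|s - t|.
  rewrite (le_trans Hs)// (le_trans (ler_wpM2l _ nsv))//.
    by rewrite divr_ge0// ltW.
  by rewrite mulrCA divfK ?gt_eqF// mulrC.
rewrite (le_trans (nrmD _ _))// (le_trans (lerD Hs' (nrmD _ _)))// nrmN nrmZr.
by have := ler_wpM2l (normr_ge0 (s - t)) Ll; lra.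
Qed.

Lemma segment_mean_value f x v L (l : R) : 0 <= l ->
  (forall t : R, 0 <= t <= 1 -> exists2 L', fder f (x + t%:C *: v) L' &
    nrm ((L' - L) v) <= l) ->
  nrm (f (x + v) - f x - L v) <= l.
Proof.
move=> l0 H; pose p (t : R) := t%:C *: L v.
have := @curve_mean_value (fun y => f (y + x)) v p (fun=> L v) l l0.
rewrite /p rmorph1 rmorph0 !scale1r scale0r subr0 add0r (addrC v); apply.
  by move=> t; have := rder_scale (L v) (is_derive_id t 1); rewrite rmorph1 scale1r.
move=> t /H[L' fL' L'l]; exists L' => //.
by apply: fder_shift; rewrite addrC.
Qed.

Definition holo f a (r : R) := forall x, nrm (x - a) < r -> differentiable f x.

Lemma holo_sub f a r b s : holo f a r -> nrm (b - a) + s <= r -> holo f b s.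
Proof. by move=> fh bs x xb; apply: fh; have := nrm_tri x b a; lra. Qed.

Lemma cauchy_estimate f a (r M : R) : 0 < r -> holo f a r ->
  (forall x, nrm (x - a) < r -> nrm (f x) <= M) ->
  nrm (frechetD f a) <= 8 * M / r.
Proof.
move=> r0 fh fM; have M0 : 0 <= M.
  by rewrite (le_trans (nrm_ge0 (f a)))// fM// subrr nrm0.
apply: nrm_op_le => [|v]; first by rewrite divr_ge0 ?mulr_ge0// ltW.
have [->|v0] := eqVneq v 0; first by rewrite linear0 !nrm0 mulr0.
have nv : 0 < nrm v.
  by rewrite lt_neqAle nrm_ge0 andbT eq_sym; apply: contra_neq v0; exact: nrm0_eq0.
(* The disc of radius [2 s] on the complex line through [a] along [v] maps into the ball of radius
   [r / 2], and [2 M / s] is the claimed bound. *)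
pose s := r / (4 * nrm v).
have s0 : 0 < s by rewrite divr_gt0 ?mulr_gt0.
have inball (z : R[i]) : modc z <= 2 * s -> nrm (a + z *: v - a) < r.
  move=> zs; rewrite addrC addKr nrmZ (le_lt_trans (ler_wpM2r (nrm_ge0 v) zs))//.
  have -> : 2 * s * nrm v = r / 2 by rewrite /s; field; rewrite gt_eqF.
  by lra.
have -> : 8 * M / r * nrm v = 2 * M / s.
  by rewrite /s; field; rewrite !gt_eqF.
apply: (@cauchy_square_le _ _ (fun z : R[i] => f (a + z *: v))) => //.
- move=> z /inball/fh/differentiable_fder H; eexists; exact: fder_slice H.
- by move=> z /inball/fM.
- have := @fder_slice f a v 0 (frechetD f a); apply.
  rewrite scale0r addr0; apply/differentiable_fder/fh.
  by rewrite subrr nrm0.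
Qed.

(** * Lipschitz and Taylor bounds for bounded holomorphic maps *)

Section BoundedHolomorphic.
Variables (f : X -> Y) (a : X) (r M : R).
Hypotheses (r0 : 0 < r) (fh : holo f a r).
Hypothesis fM : forall x, nrm (x - a) < r -> nrm (f x) <= M.

Lemma holo_derivative_le x : nrm (x - a) < r / 2 -> nrm (frechetD f x) <= 16 * M / r.
Proof.
move=> xa; have r20 : 0 < r / 2 by have := r0; lra.
have -> : 16 * M / r = 8 * M / (r / 2) by field; rewrite gt_eqF.
apply: cauchy_estimate => //; first by apply: holo_sub fh _; lra.
by move=> y yx; apply: fM; have := nrm_tri y x a; lra.
Qed.

Lemma holo_lipschitz x v : nrm (x - a) < r / 2 -> nrm (x + v - a) < r / 2 ->
  nrm (f (x + v) - f x) <= 16 * M / r * nrm v.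
Proof.
move=> xa xva; have M0 : 0 <= M.
  by rewrite (le_trans (nrm_ge0 (f a)))// fM// subrr nrm0.
have C0 : 0 <= 16 * M / r by rewrite divr_ge0 ?mulr_ge0// ltW.
have := @segment_mean_value f x v 0 (16 * M / r * nrm v).
have -> : (0 : bounded_operator X Y) v = 0 by [].
rewrite subr0; apply; first by rewrite mulr_ge0 ?nrm_ge0.
move=> t /andP[t0 t1].
have xt : nrm (x + t%:C *: v - a) < r / 2.
  have -> : x + t%:C *: v - a = (1 - t)%:C *: (x - a) + t%:C *: (x + v - a).
    by rewrite rmorphB rmorph1 /=; linear_identity; ring.
  rewrite (le_lt_trans (nrmD _ _))// !nrmZr (ger0_norm t0) (@ger0_norm _ (1 - t)); last by lra.
  move: xa xva; set A := nrm (x - a); set B := nrm (x + v - a) => xa xva.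
  have [AB|/ltW BA] := leP A B.
    by apply: (@le_lt_trans _ _ B) => //; nra.
  by apply: (@le_lt_trans _ _ A) => //; nra.
exists (frechetD f (x + t%:C *: v)); first by apply/differentiable_fder/fh; have := r0; lra.
rewrite subr0 (le_trans (nrm_app _ _))// ler_wpM2r ?nrm_ge0//.
exact: holo_derivative_le.
Qed.

(** Cauchy's estimate for [y |-> f (y + v) - f y], which is of size [nrm v] by [holo_lipschitz]: no
    second derivative is involved. *)
Lemma holo_derivative_lipschitz x v : nrm (x - a) < r / 8 -> nrm v < r / 8 ->
  nrm (frechetD f (x + v) - frechetD f x) <= 32 ^+ 2 * M / r ^+ 2 * nrm v.
Proof.
move=> xa vr; pose g y := f (y + v) - f y.
have r80 : 0 < r / 8 by have := r0; lra.
have inb y : nrm (y - x) < r / 8 -> nrm (y - a) < r / 2 /\ nrm (y + v - a) < r / 2.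
  move=> yx; have ya : nrm (y - a) < r / 4 by have := nrm_tri y x a; lra.
  by rewrite addrAC; have := nrmD (y - a) v; lra.
have gd y : nrm (y - x) < r / 8 -> fder g y (frechetD f (y + v) - frechetD f y).
  move=> /inb[h1 h2]; apply: fderB; last by apply/differentiable_fder/fh; have := r0; lra.
  by apply/fder_shift/differentiable_fder/fh; have := r0; lra.
have -> : frechetD f (x + v) - frechetD f x = frechetD g x.
  by rewrite (fder_differentiable (gd x _)).2// subrr nrm0.
have -> : 32 ^+ 2 * M / r ^+ 2 * nrm v = 8 * (16 * M / r * nrm v) / (r / 8).
  by field; rewrite gt_eqF.
apply: cauchy_estimate => // [y /gd/fder_differentiable[]//|y /inb[h1 h2]].
exact: holo_lipschitz.
Qed.

Lemma holo_taylor2 x v : nrm (x - a) < r / 8 -> nrm v < r / 8 ->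
  nrm (f (x + v) - f x - frechetD f x v) <= 32 ^+ 2 * M / r ^+ 2 * nrm v ^+ 2.
Proof.
move=> xa vr; have M0 : 0 <= M.
  by rewrite (le_trans (nrm_ge0 (f a)))// fM// subrr nrm0.
have C0 : 0 <= 32 ^+ 2 * M / r ^+ 2 by rewrite divr_ge0 ?mulr_ge0 ?exprn_ge0// ltW.
apply: segment_mean_value => [|t /andP[t0 t1]]; first by rewrite mulr_ge0 ?exprn_ge0 ?nrm_ge0.
have tv : nrm (t%:C *: v) <= nrm v.
  by rewrite nrmZr ger0_norm//; have := nrm_ge0 v; nra.
exists (frechetD f (x + t%:C *: v)).
  apply/differentiable_fder/fh; rewrite addrAC.
  by have := nrmD (x - a) (t%:C *: v); have := nrm_ge0 v; lra.
have := @holo_derivative_lipschitz x (t%:C *: v) xa (le_lt_trans tv vr) => H.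
rewrite (le_trans (nrm_app _ _))// expr2 mulrA ler_wpM2r ?nrm_ge0//.
by rewrite (le_trans H)// ler_wpM2l.
Qed.

End BoundedHolomorphic.

End FrechetCalculus.

(** * Holomorphy of the derivative *)

(* Sequential completeness, in a form that passes to spaces of operators. *)
Definition seq_complete (R : realType) (Y : normedModType R[i]) :=
  forall (u : nat -> Y) (C : R),
    (forall n m, (n <= m)%N -> nrm (u n - u m) <= C / n.+1%:R) ->
    exists l, forall n, nrm (u n - l) <= C / n.+1%:R.

Lemma inv_nat_small (R : realType) (C e : R) : 0 < e -> exists n : nat, C / n.+1%:R < e.
Proof.
move=> e0; have [C0|C0] := leP C 0.
  exists 0%N; rewrite divr1; exact: le_lt_trans C0 e0.
have := archi_boundP (ltW (divr_gt0 C0 e0)); set n := Num.bound _ => nC.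
exists n; rewrite ltr_pdivrMr// mulrC -ltr_pdivrMr// (lt_trans nC)//.
by rewrite ltr_nat.
Qed.

Lemma nrm_le_inv_nat (R : realType) (x y C : R) :
  (forall n : nat, x <= y + C / n.+1%:R) -> x <= y.
Proof.
move=> H; apply/ler_addgt0Pr => e /(inv_nat_small C)[n nC].
by rewrite (le_trans (H n))// lerD2l ltW.
Qed.

Lemma complete_seq_complete (R : realType) (Y : completeNormedModType R[i]) :
  seq_complete Y.
Proof.
move=> u C uC.
have /cauchy_cvg ucvg : cauchy (u @ \oo).
  apply: cauchy_exP => e e0; have eE : (complex.Re e)%:C = e by rewrite RRe_real// gtr0_real.
  have /(inv_nat_small C)[N NC] : 0 < complex.Re e by rewrite -ltcR eE.
  exists (u N); exists N => // n /= Nn; rewrite -ball_normE /= -eE nrmC ltcR.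
  exact: le_lt_trans (uC _ _ Nn) NC.
exists (lim (u @ \oo)) => n; apply/ler_addgt0Pr => e e0.
have /cvgrPdist_lt/(_ e%:C) := ucvg; rewrite ltcR => /(_ e0)[N _ /= HN].
have := HN (maxn N n) (leq_maxl _ _); rewrite nrmC ltcR => h.
have := uC n (maxn N n) (leq_maxr _ _).
have := nrm_tri (u n) (u (maxn N n)) (lim (u @ \oo)).
by rewrite (nrmB (u (maxn N n)) (lim _)); move: (C / _) => q; lra.
Qed.

(** Pointwise limits exist with the rate [C * nrm x / n.+1]. Being uniform on the unit ball, it
    yields convergence in operator norm and a bound for the limit. *)
Lemma bounded_operator_seq_complete (R : realType) (X Y : normedModType R[i]) :
  seq_complete Y -> seq_complete (bounded_operator X Y).
Proof.
move=> Yc u C uC.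
have C0 : 0 <= C by have := uC 0%N 0%N (leqnn _); rewrite subrr nrm0 divr1.
have limP x : exists l, forall n, nrm (u n x - l) <= C * nrm x / n.+1%:R.
  apply: Yc => n m nm; have := nrm_app (u n - u m) x; rewrite addopE oppopE => h.
  by rewrite (le_trans h)// mulrAC ler_wpM2r ?nrm_ge0 ?uC.
have [l lP] := choice limP.
have ll : linear l.
  move=> c x y; apply/eqP; rewrite -subr_eq0; apply/eqP/nrm0_eq0/eqP.
  rewrite eq_le nrm_ge0 andbT.
  apply: (@nrm_le_inv_nat _ _ _ (C * nrm (c *: x + y) + modc c * (C * nrm x) + C * nrm y)) => n.
  have -> : l (c *: x + y) - (c *: l x + l y)
     = - (u n (c *: x + y) - l (c *: x + y)) + (c *: (u n x - l x) + (u n y - l y)).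
    by rewrite (linearP (u n)) /=; linear_identity; ring.
  rewrite add0r (le_trans (nrmD _ _))// nrmN 2!mulrDl -addrA lerD ?lP//.
  by rewrite (le_trans (nrmD _ _))// lerD ?lP// nrmZ -mulrA ler_wpM2l ?modc_ge0.
have lb x : nrm (l x) <= (C + nrm (u 0%N)) * nrm x.
  have := lP x 0%N; rewrite divr1 nrmB => h; rewrite mulrDl.
  by rewrite (le_trans (nrm_le_sub _ (u 0%N x)))// lerD// nrm_app.
have [L LE] := mk_bounded_operator ll lb.
exists L => n; apply: nrm_op_le => [|x]; first by rewrite divr_ge0.
by rewrite addopE oppopE LE mulrAC; exact: lP.
Qed.

Section HolomorphicLimits.
Variables (R : realType) (X Y : normedModType R[i]).
Hypothesis Ycomplete : seq_complete Y.
Implicit Types (f : X -> Y) (a v w : X).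

(** Cauchy's estimate for [phi n - phi m] makes the derivatives at [a] converge, which is where
    completeness of [Y] enters. The quadratic remainder bound of [holo_taylor2] depends only on [M]
    and [r], hence survives the limit. *)
Lemma holo_limit (phi : nat -> X -> Y) (psi : X -> Y) a (r M C : R) : 0 < r ->
  (forall n, holo (phi n) a r) ->
  (forall n x, nrm (x - a) < r -> nrm (phi n x) <= M) ->
  (forall n x, nrm (x - a) < r -> nrm (phi n x - psi x) <= C / n.+1%:R) ->
  differentiable psi a.
Proof.
move=> r0 phih phiM phipsi.
have aa : nrm (a - a) < r by rewrite subrr nrm0.
have M0 : 0 <= M by rewrite (le_trans (nrm_ge0 (phi 0%N a)))// phiM.
have C0 : 0 <= C.
  by have := phipsi 0%N a aa; rewrite divr1; apply: le_trans; exact: nrm_ge0.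
have dphi n x : nrm (x - a) < r -> fder (phi n) x (frechetD (phi n) x).
  by move=> xa; apply/differentiable_fder/phih.
pose u n := frechetD (phi n) a.
have uC n m : (n <= m)%N -> nrm (u n - u m) <= 16 * C / r / n.+1%:R.
  move=> nm; have D x : nrm (x - a) < r ->
      fder (fun y => phi n y - phi m y) x (frechetD (phi n) x - frechetD (phi m) x).
    by move=> xa; apply: fderB; exact: dphi.
  rewrite /u -(fder_differentiable (D a aa)).2.
  have -> : 16 * C / r / n.+1%:R = 8 * (2 * C / n.+1%:R) / r by ring.
  apply: cauchy_estimate => // x xa; first exact: (fder_differentiable (D x xa)).1.
  have := phipsi n x xa; have := phipsi m x xa.
  have : C / m.+1%:R <= C / n.+1%:R by rewrite ler_wpM2l// lef_pV2 ?posrE// ler_nat.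
  have := nrm_tri (phi n x) (psi x) (phi m x); rewrite (nrmB (psi x)) -mulrA.
  by move: (C / n.+1%:R) (C / m.+1%:R) => q q'; lra.
have [L LP] := bounded_operator_seq_complete Ycomplete uC.
have r80 : 0 < r / 8 by lra.
pose A := 32 ^+ 2 * M / r ^+ 2.
have A0 : 0 <= A by rewrite divr_ge0 ?mulr_ge0 ?exprn_ge0// ltW.
suff psiL : fder psi a L by have [] := fder_differentiable psiL.
move=> e e0; exists (Num.min (r / 8) (e / (A + 1))); first by rewrite lt_min r80 divr_gt0; lra.
move=> v; rewrite lt_min => /andP[vr]; rewrite ltr_pdivlMr; last by lra.
move=> vA; apply: (@le_trans _ _ (A * nrm v ^+ 2)); last first.
  by rewrite expr2 mulrA ler_wpM2r ?nrm_ge0//; have := nrm_ge0 v; lra.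
apply: (@nrm_le_inv_nat _ _ _ (2 * C + 16 * C / r * nrm v)) => n.
have ava : nrm (a + v - a) < r by rewrite addrC addKr; lra.
have -> : psi (a + v) - psi a - L v = (phi n (a + v) - phi n a - u n v)
    + (- (phi n (a + v) - psi (a + v)) + (phi n a - psi a) + (u n - L) v).
  by rewrite addopE oppopE; linear_identity; ring.
rewrite (le_trans (nrmD _ _))// lerD//.
  have aa8 : nrm (a - a) < r / 8 by rewrite subrr nrm0.
  by have := holo_taylor2 r0 (phih n) (phiM n) aa8 vr.
rewrite (le_trans (nrmD _ _))// mulrDl lerD//.
  rewrite (le_trans (nrmD _ _))// nrmN.
  have := phipsi n _ ava; have := phipsi n a aa; rewrite -mulrA.
  by move: (C / n.+1%:R) => q; lra.
by rewrite (le_trans (nrm_app _ _))// mulrAC ler_wpM2r ?nrm_ge0.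
Qed.

Section BoundedHolo.
Variables (f : X -> Y) (M : R).

Lemma holo_directional a (r : R) w : 0 < r -> holo f a r ->
  (forall x, nrm (x - a) < r -> nrm (f x) <= M) ->
  differentiable (fun x => frechetD f x w) a.
Proof.
move=> r0 fh fM; have aa : nrm (a - a) < r by rewrite subrr nrm0.
have M0 : 0 <= M by rewrite (le_trans (nrm_ge0 (f a)))// fM.
have w1 : 0 < nrm w + 1 by have := nrm_ge0 w; lra.
have r80 : 0 < r / 8 by lra.
(* Every increment [(c / n.+1) w] is then shorter than [r / 8], as [holo_taylor2] requires; dividing
   its quadratic bound by the step gives the rate [1 / n.+1]. *)
pose c : R := r / (8 * (nrm w + 1)).
have c0 : 0 < c by rewrite divr_gt0// mulr_gt0.
pose eps n : R := c / n.+1%:R.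
have eps0 n : 0 < eps n by rewrite divr_gt0.
have epsc n : eps n <= c by rewrite ler_pdivrMr// ler_peMr ?(ltW c0)// ler1n.
have epsw n : nrm ((eps n)%:C *: w) < r / 8.
  rewrite nrmZr gtr0_norm// (le_lt_trans (ler_wpM2r (nrm_ge0 w) (epsc n)))//.
  have -> : r / 8 = c * (nrm w + 1) by rewrite /c; field; rewrite gt_eqF.
  by rewrite ltr_pM2l//; lra.
pose phi n x := ((eps n)^-1)%:C *: (f (x + (eps n)%:C *: w) - f x).
have inb n x : nrm (x - a) < r / 8 -> nrm (x + (eps n)%:C *: w - a) < r / 2 /\ nrm (x - a) < r / 2.
  move=> xa; rewrite addrAC; have := nrmD (x - a) ((eps n)%:C *: w); have := epsw n; lra.
have invE n : modc ((eps n)^-1)%:C = (eps n)^-1.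
  by rewrite modc_real gtr0_norm// invr_gt0.
apply: (@holo_limit phi _ _ (r / 8) (16 * M / r * nrm w)
  (32 ^+ 2 * M / r ^+ 2 * c * nrm w ^+ 2) r80).
- move=> n x /(inb n)[h1 h2].
  have D := fderB (fder_shift (differentiable_fder (fh (x + (eps n)%:C *: w) ltac:(lra))))
    (differentiable_fder (fh x ltac:(lra))).
  exact: (fder_differentiable (fderZ ((eps n)^-1)%:C D)).1.
- move=> n x /(inb n)[h1 h2]; have := holo_lipschitz r0 fh fM h2 h1.
  rewrite nrmZr gtr0_norm// => h; rewrite /phi nrmZ invE.
  rewrite (le_trans (ler_wpM2l _ h)) ?invr_ge0 ?(ltW (eps0 n))//.
  have e0 := eps0 n; move: (eps n) e0 => d d0.
  have -> : d^-1 * (16 * M / r * (d * nrm w)) = 16 * M / r * nrm w.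
    by field; rewrite !gt_eqF.
  by [].
- move=> n x xa; have := holo_taylor2 r0 fh fM xa (epsw n).
  have -> : phi n x - frechetD f x w = ((eps n)^-1)%:C *:
      (f (x + (eps n)%:C *: w) - f x - frechetD f x ((eps n)%:C *: w)).
    have E : ((eps n)^-1)%:C * (eps n)%:C = 1 :> R[i] by rewrite -rmorphM /= mulVf ?gt_eqF.
    by rewrite opZ /phi; linear_identity; ring: E.
  move=> h; rewrite nrmZ invE (le_trans (ler_wpM2l _ h)) ?invr_ge0 ?(ltW (eps0 n))//.
  rewrite nrmZr gtr0_norm//.
  have -> : 32 ^+ 2 * M / r ^+ 2 * c * nrm w ^+ 2 / n.+1%:R = 
    32 ^+ 2 * M / r ^+ 2 * eps n * nrm w ^+ 2 by rewrite /eps; ring.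
  have e0 := eps0 n; move: (eps n) e0 => d d0.
  have -> : d^-1 * (32 ^+ 2 * M / r ^+ 2 * (d * nrm w) ^+ 2)
      = 32 ^+ 2 * M / r ^+ 2 * d * nrm w ^+ 2.
    by field; rewrite !gt_eqF.
  by [].
Qed.

(** The candidate [B] has its arguments exchanged: [B v] is the derivative at [a] of
    [x |-> Df(x) v]. In this form [Df(a + v) - Df(a) - B v] is the derivative at [a] of the
    remainder [T], which is quadratic in [v]. The exchange is recorded in the conclusion, for the
    symmetry of the second derivative. *)
Lemma holo_derivative a (r : R) : 0 < r -> holo f a r ->
  (forall x, nrm (x - a) < r -> nrm (f x) <= M) ->
  differentiable (frechetD f) a /\
  forall v w, frechetD (frechetD f) a v w = frechetD (fun x => frechetD f x v) a w.
Proof.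
move=> r0 fh fM; have aa : nrm (a - a) < r by rewrite subrr nrm0.
have M0 : 0 <= M by rewrite (le_trans (nrm_ge0 (f a)))// fM.
have r20 : 0 < r / 2 by lra. have r80 : 0 < r / 8 by lra.
have dD v x : nrm (x - a) < r / 2 ->
    fder (fun x => frechetD f x v) x (frechetD (fun x => frechetD f x v) x).
  move=> xa; apply: differentiable_fder; apply: (holo_directional _ r20).
    by apply: holo_sub fh _; lra.
  by move=> y yx; apply: fM; have := nrm_tri y x a; lra.
pose b v := frechetD (fun x => frechetD f x v) a.
have aa2 : nrm (a - a) < r / 2 by rewrite subrr nrm0.
have bl : linear b.
  move=> c v w; have H := fderD (fderZ c (dD v a aa2)) (dD w a aa2).
  rewrite /b -(fder_differentiable H).2; congr frechetD.
  by apply/funext => x; rewrite opP.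
have bb v : nrm (b v) <= 16 ^+ 2 * M / r ^+ 2 * nrm v.
  have -> : 16 ^+ 2 * M / r ^+ 2 * nrm v = 8 * (16 * M / r * nrm v) / (r / 2).
    by field; rewrite gt_eqF.
  apply: cauchy_estimate => // x xa; first exact: (fder_differentiable (dD v x xa)).1.
  rewrite (le_trans (nrm_app _ _))// ler_wpM2r ?nrm_ge0//.
  by have := holo_derivative_le r0 fh fM xa.
have [B BE] := mk_bounded_operator bl bb.
suff H : fder (frechetD f) a B.
  have [d ->] := fder_differentiable H; split => // v w.
  by rewrite BE.
pose A := 8 * 32 ^+ 2 * 8 * M / r ^+ 3.
have A0 : 0 <= A by rewrite divr_ge0 ?mulr_ge0 ?exprn_ge0// ltW.
move=> e e0; exists (Num.min (r / 8) (e / (A + 1))); first by rewrite lt_min r80 divr_gt0; lra.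
move=> v; rewrite lt_min => /andP[vr]; rewrite ltr_pdivlMr; last by lra.
move=> vA; apply: (@le_trans _ _ (A * nrm v ^+ 2)); last first.
  by rewrite expr2 mulrA ler_wpM2r ?nrm_ge0//; have := nrm_ge0 v; lra.
pose T x := f (x + v) - f x - frechetD f x v.
have TD x : nrm (x - a) < r / 8 -> fder T x
    (frechetD f (x + v) - frechetD f x - frechetD (fun x => frechetD f x v) x).
  move=> xa; apply: fderB; last by apply: dD; lra.
  apply: fderB; last by apply/differentiable_fder/fh; lra.
  apply/fder_shift/differentiable_fder/fh; rewrite addrAC.
  by have := nrmD (x - a) v; lra.
have aa8 : nrm (a - a) < r / 8 by rewrite subrr nrm0.
have -> : frechetD f (a + v) - frechetD f a - B v = frechetD T a.
  by rewrite (fder_differentiable (TD a aa8)).2 BE.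
have -> : A * nrm v ^+ 2 = 8 * (32 ^+ 2 * M / r ^+ 2 * nrm v ^+ 2) / (r / 8).
  by rewrite /A; field; rewrite gt_eqF.
apply: cauchy_estimate => // x xa; first exact: (fder_differentiable (TD x xa)).1.
by have := holo_taylor2 r0 fh fM xa vr.
Qed.

End BoundedHolo.

Lemma holo_locally_bounded f a (r : R) : 0 < r -> holo f a r ->
  exists s M, [/\ 0 < s, holo f a s & forall x, nrm (x - a) < s -> nrm (f x) <= M].
Proof.
move=> r0 fh; have aa : nrm (a - a) < r by rewrite subrr nrm0.
have [d d0 dP] := fder_continuous (differentiable_fder (fh a aa)).
exists (Num.min r d), (nrm (f a) + (nrm (frechetD f a) + 1) * d).
split; first by rewrite lt_min r0.
  by move=> x; rewrite lt_min => /andP[/fh].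
move=> x; rewrite lt_min => /andP[_ /dP].
by rewrite addrC subrK.
Qed.

Lemma holo_frechetD f a (r : R) : holo f a r -> holo (frechetD f) a r.
Proof.
move=> fh x xa; have xr : 0 < r - nrm (x - a) by lra.
have fx : holo f x (r - nrm (x - a)) by apply: holo_sub fh _; lra.
have [s [M [s0 fs fM]]] := holo_locally_bounded xr fx.
exact: (holo_derivative s0 fs fM).1.
Qed.

(** [holo_derivative] equates the left side with the derivative of [x |-> Df(x) v] along [w]; by
    [fder_app] that is the right side. *)
Lemma frechetD2_sym f a (r : R) v w : 0 < r -> holo f a r ->
  frechetD (frechetD f) a v w = frechetD (frechetD f) a w v.
Proof.
move=> r0 fh; have [s [M [s0 fs fM]]] := holo_locally_bounded r0 fh.
have [d E] := holo_derivative s0 fs fM; rewrite E.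
have [||B BE] := @mk_bounded_operator R X Y (fun w => frechetD (frechetD f) a w v)
  (nrm (frechetD (frechetD f) a) * nrm v).
- by move=> c x y; rewrite opP.
- move=> x; rewrite (le_trans (nrm_app _ _))// mulrAC ler_wpM2r ?nrm_ge0//.
  exact: nrm_app.
have := fder_app (differentiable_fder d) (w := v) (B := B).
rewrite BE => /(_ (fun=> erefl)) H.
by rewrite (fder_differentiable H).2 BE.
Qed.

End HolomorphicLimits.

(** * Taylor expansion *)

Section Taylor.
Variables (R : realType) (X : normedModType R[i]).

Lemma holo_segment (Y : normedModType R[i]) (f : X -> Y) (r : R) (t : R) v :
  holo f 0 r -> nrm v < r -> 0 <= t <= 1 ->
  fder f (t%:C *: v) (frechetD f (t%:C *: v)) /\ nrm (t%:C *: v) <= nrm v.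
Proof.
move=> fh vr /andP[t0 t1].
have tv : nrm (t%:C *: v) <= nrm v by rewrite nrmZr ger0_norm//; have := nrm_ge0 v; nra.
by split => //; apply/differentiable_fder/fh; rewrite subr0; lra.
Qed.

Lemma taylor2 (Y : normedModType R[i]) (f : X -> Y) (r : R) A : 0 < r ->
  holo f 0 r -> fder (frechetD f) 0 A -> forall e : R, 0 < e ->
  exists2 d : R, 0 < d & forall v, nrm v < d ->
    nrm (f v - f 0 - frechetD f 0 v - 2^-1 *: A v v) <= e * nrm v ^+ 2.
Proof.
move=> r0 fh fA e e0; have [d d0 dP] := fA e e0.
exists (Num.min d r) => [|v]; first by rewrite lt_min d0.
rewrite lt_min => /andP[vd vr].
pose p (t : R) := t%:C *: frechetD f 0 v + (t ^+ 2 / 2)%:C *: A v v.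
pose p' (t : R) := (1 : R)%:C *: frechetD f 0 v + t%:C *: A v v.
have pE : frechetD f 0 v + 2^-1 *: A v v = p 1 - p 0.
  rewrite /p expr1n expr0n /= mul0r rmorphM rmorph1 fmorphV rmorph_nat.
  by linear_identity; ring.
rewrite -addrA -opprD pE; apply: (@curve_mean_value _ _ _ _ _ _ p').
- by rewrite mulr_ge0 ?exprn_ge0 ?nrm_ge0// ltW.
- move=> t; apply: rderD; apply: rder_scale.
  by apply: is_derive_eq; rewrite /GRing.scale /=; field.
move=> t t01; have [fd tv] := holo_segment fh vr t01.
exists (frechetD f (t%:C *: v)) => //.
have := dP _ (le_lt_trans tv vd); rewrite add0r opZ => h.
have -> : frechetD f (t%:C *: v) v - p' t =
    (frechetD f (t%:C *: v) - frechetD f 0 - t%:C *: A v) v.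
  by rewrite /p' !addopE !oppopE scaleopE; linear_identity; ring.
rewrite (le_trans (nrm_app _ _))// expr2 mulrA ler_wpM2r ?nrm_ge0//.
by rewrite (le_trans h)// ler_wpM2l// ltW.
Qed.

(** [taylor2] for [Df], integrated along the segment by [curve_mean_value]; [p'] is the quadratic
    expansion of [Df (t v) v]. *)
Lemma taylor3 (Y : normedModType R[i]) (f : X -> Y) (r : R) A C : 0 < r ->
  holo f 0 r -> holo (frechetD f) 0 r -> A = frechetD (frechetD f) 0 ->
  fder (frechetD (frechetD f)) 0 C -> forall e : R, 0 < e ->
  exists2 d : R, 0 < d & forall v, nrm v < d ->
    nrm (f v - f 0 - frechetD f 0 v - 2^-1 *: A v v - 6^-1 *: C v v v)
      <= e * nrm v ^+ 3.
Proof.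
move=> r0 fh Dfh AE fC e e0; have [d d0 dP] := taylor2 r0 Dfh fC e0.
exists (Num.min d r) => [|v]; first by rewrite lt_min d0.
rewrite lt_min => /andP[vd vr].
pose p (t : R) := t%:C *: frechetD f 0 v + (t ^+ 2 / 2)%:C *: A v v
  + (t ^+ 3 / 6)%:C *: C v v v.
pose p' (t : R) := (1 : R)%:C *: frechetD f 0 v + t%:C *: A v v
  + (t ^+ 2 / 2)%:C *: C v v v.
have pE : frechetD f 0 v + 2^-1 *: A v v + 6^-1 *: C v v v = p 1 - p 0.
  rewrite /p !expr1n !expr0n /= !mul0r !rmorphM rmorph1 !fmorphV !rmorph_nat.
  by linear_identity; ring.
rewrite -2!addrA -!opprD addrA pE; apply: (@curve_mean_value _ _ _ _ _ _ p').
- by rewrite mulr_ge0 ?exprn_ge0 ?nrm_ge0// ltW.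
- move=> t; apply: rderD; [apply: rderD|]; apply: rder_scale.
    by apply: is_derive_eq; rewrite /GRing.scale /=; field.
  by apply: is_derive_eq; rewrite /GRing.scale /=; field.
move=> t t01; have [fd tv] := holo_segment fh vr t01.
exists (frechetD f (t%:C *: v)) => //.
have := dP _ (le_lt_trans tv vd); rewrite -AE opZ.
have -> : C (t%:C *: v) (t%:C *: v) = t%:C *: (t%:C *: C v v) by rewrite !opZ.
move=> h.
have -> : frechetD f (t%:C *: v) v - p' t =
    (frechetD f (t%:C *: v) - frechetD f 0 - t%:C *: A v
     - 2^-1 *: (t%:C *: (t%:C *: C v v))) v.
  rewrite /p' !addopE !oppopE !scaleopE rmorphM rmorphXn fmorphV rmorph_nat.
  by linear_identity; ring.
rewrite (le_trans (nrm_app _ _))// exprSr mulrA ler_wpM2r ?nrm_ge0//.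
rewrite (le_trans h)// ler_wpM2l ?(ltW e0)//.
by rewrite lerXn2r// nnegrE nrm_ge0.
Qed.

End Taylor.

(** * Approximate solutions of the initial value problem *)

Section Gronwall.
Variables (R : realType) (X : normedModType R[i]).
Variables (h : X -> X) (v w w' : R -> X) (T K eta rho : R).
Hypotheses (K0 : 0 <= K) (eta0 : 0 < eta).
Hypothesis h_lip : forall x y, nrm x < rho -> nrm y < rho ->
  nrm (h x - h y) <= K * nrm (x - y).
Hypothesis v_der : forall t, 0 <= t <= T -> forall e : R, 0 < e ->
  exists2 d : R, 0 < d & forall s, 0 <= s -> `|s - t| < d ->
    nrm (v s - v t + (s - t)%:C *: h (v t)) <= e * `|s - t|.
Hypothesis w_der : forall t, rder w t (w' t).
Hypothesis w_approx : forall t, 0 <= t <= T -> nrm (w' t + h (w t)) <= eta.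
Hypothesis w_small : forall t, 0 <= t <= T -> nrm (w t) < rho / 2.
Hypothesis vw0 : v 0 = w 0.

(** Barrier for the error, which over a short step grows at rate at most [K E + eta + eta / 2]:
    Lipschitz term, residual, and two derivative errors [eta / 4]. As [E >= 2 eta] for nonnegative
    times, this is below the slope [(K + 1) E]. *)
Let E (t : R) := 2 * eta * expR ((K + 1) * t).

Let E_gt0 t : 0 < E t.
Proof. by rewrite !mulr_gt0// expR_gt0. Qed.

Let E_mono s t : s <= t -> E s <= E t.
Proof.
move=> st; have := K0 => k0.
by rewrite /E ler_pM2l ?mulr_gt0// ler_expR ler_wpM2l//; lra.
Qed.

Let E_growth s t : E t + (s - t) * ((K + 1) * E t) <= E s.
Proof.
have -> : E s = E t * expR ((K + 1) * (s - t)).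
  by rewrite /E (_ : (K + 1) * s = (K + 1) * t + (K + 1) * (s - t)) ?expRD; ring.
have := expR_ge1Dx ((K + 1) * (s - t)); have := E_gt0 t; nra.
Qed.

Hypothesis E_small : E T < rho / 2.

Lemma approximate_solution t : 0 <= t <= T ->
  nrm (v t - w t) <= 2 * eta * expR ((K + 1) * t).
Proof.
move=> tT; suff : 0 <= E t - nrm (v t - w t) by rewrite /E; lra.
have dE t' s : v s - w s - (v t' - w t') =
    (v s - v t' + (s - t')%:C *: h (v t')) - (w s - w t' - (s - t')%:C *: w' t')
    + (- (s - t'))%:C *: (h (v t') + w' t').
  by rewrite rmorphN /=; linear_identity; ring.
move: t tT; apply: real_induction.
- by rewrite vw0 subrr nrm0 subr0 ltW.
- move=> t t0T ft; have /andP[t0 tT] := t0T.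
  have e4 : 0 < eta / 4 by have := eta0; lra.
  have [d d0 dP] := v_der t0T e4.
  have [d' d'0 d'P] := w_der t e4.
  exists (Num.min d d') => [|s /andP[ts sd] sT]; first by rewrite lt_min d0.
  have s0 : 0 <= s by lra.
  have st0 : 0 < s - t by lra.
  have [sd1 sd2] : s - t < d /\ s - t < d'.
    by move: sd; rewrite -ltrBlDl lt_min => /andP.
  have := dP s s0; rewrite gtr0_norm// => /(_ sd1) H1.
  have := d'P s; rewrite gtr0_norm// => /(_ sd2) H2.
  have ET := E_mono tT; have Es := E_small.
  have wt := w_small t0T.
  (* The Lipschitz bound is only local: [v] stays in its ball because the error so far is at most
     [E T < rho / 2]. *)
  have vt : nrm (v t) < rho by have := nrm_le_sub (v t) (w t); lra.
  have Et := E_gt0 t.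
  have wt' : nrm (w t) < rho by lra.
  have H3 : nrm (h (v t) + w' t) <= K * E t + eta.
    have -> : h (v t) + w' t = (h (v t) - h (w t)) + (w' t + h (w t)).
      by linear_identity; ring.
    rewrite (le_trans (nrmD _ _))// lerD ?w_approx// (le_trans (h_lip vt wt'))//.
    by rewrite ler_wpM2l//; lra.
  have H4 : nrm (v s - w s) <= nrm (v t - w t) + (s - t) * (K * E t + eta + eta / 2).
    have := nrm_le_sub (v s - w s) (v t - w t); rewrite dE.
    set a := v s - _ + _; set b := w s - _ - _; set c := _ *: (h (v t) + _).
    have := nrmD (a - b) c; have := nrm_sub_le a b.
    have : nrm c <= (s - t) * (K * E t + eta).
      by rewrite nrmZr normrN gtr0_norm// ler_wpM2l// ltW.
    by lra.
  have := E_growth s t; have E2 : 2 * eta <= E t.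
    rewrite /E ler_peMr ?mulr_ge0 ?(ltW eta0)//.
    by rewrite -[leLHS]expR0 ler_expR mulr_ge0//; have := K0; lra.
  by nra.
- move=> t t0T e e0; have /andP[t0 tT] := t0T.
  pose B := nrm (h (v t) + w' t) + 2.
  have B0 : 0 < B by have := nrm_ge0 (h (v t) + w' t); rewrite /B; lra.
  have [d d0 dP] := v_der t0T ltr01.
  have [d' d'0 d'P] := w_der t ltr01.
  exists (Num.min (e / B) (Num.min d d')); first by rewrite !lt_min d0 d'0 divr_gt0.
  move=> s /andP[]; rewrite ltrBlDr -ltrBlDl !lt_min => /and3P[eB sd1 sd2] st s0.
  have := dP s s0; rewrite distrC ger0_norm ?subr_ge0// => /(_ sd1) H1.
  have := d'P s; rewrite distrC ger0_norm ?subr_ge0// => /(_ sd2) H2.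
  have Es := E_mono st.
  suff : nrm (v t - w t) <= nrm (v s - w s) + e by lra.
  have := nrm_le_sub (v t - w t) (v s - w s); rewrite (nrmB (v t - w t)) dE.
  set a := v s - _ + _ in H1 *; set b := w s - _ - _ in H2 *; set c := _ *: (h (v t) + _).
  have := nrmD (a - b) c; have := nrm_sub_le a b.
  have : nrm c = (t - s) * (B - 2).
    by rewrite nrmZr opprB ger0_norm ?subr_ge0// /B addrK.
  move: eB; rewrite ltr_pdivlMr//; lra.
Qed.

End Gronwall.

(** * Uniqueness of asymptotic expansions *)

Lemma expansion_step (R : realType) (Y : normedModType R[i]) (c : Y) (p : R -> Y)
    (M : R) (n : nat) :
  (forall z, 0 < z < 1 -> nrm (p z) <= M) ->
  (forall e : R, 0 < e -> exists2 d : R, 0 < d & forall z, 0 < z < d ->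
    nrm (c + z%:C *: p z) <= e * z ^+ n.+1) ->
  c = 0 /\
  (forall e : R, 0 < e -> exists2 d : R, 0 < d & forall z, 0 < z < d ->
    nrm (p z) <= e * z ^+ n).
Proof.
move=> pM H.
have M0 : 0 <= M by rewrite (le_trans (nrm_ge0 (p 2^-1)))// pM//; lra.
have c0 : c = 0.
  apply: nrm_le_eps => e e0; have e2 : 0 < e / 2 by lra.
  have [d d0 dP] := H _ e2; have M1 : 0 < M + 1 by lra.
  (* Small enough that both [z%:C *: p z] and the right-hand side of the hypothesis are at most
     [e / 2]. *)
  pose z := Num.min (d / 2) (Num.min (1 / 2) (e / (2 * (M + 1)))).
  have z0 : 0 < z by rewrite !lt_min !divr_gt0//; lra.
  have zd : z < d by rewrite gt_min; apply/orP; left; lra.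
  have z1 : z < 1 by rewrite !gt_min; apply/orP; right; apply/orP; left; lra.
  have ze : z * (M + 1) <= e / 2.
    rewrite -ler_pdivlMr// !ge_min; apply/orP; right; apply/orP; right.
    have -> : e / 2 / (M + 1) = e / (2 * (M + 1)) by field; rewrite gt_eqF.
    exact: lexx.
  have := dP z; rewrite z0 zd => /(_ isT) h1.
  have zn : z ^+ n.+1 <= 1 by rewrite exprn_ile1 ?ltW.
  have h2 : nrm (z%:C *: p z) <= z * M.
    by rewrite nrmZr gtr0_norm// ler_wpM2l ?pM ?z0 ?(ltW z0).
  have h3 : e / 2 * z ^+ n.+1 <= e / 2 by rewrite ler_piMr ?(ltW e2).
  have := nrm_sub_le (c + z%:C *: p z) (z%:C *: p z); rewrite addrK; lra.
split=> // e /H[d d0 dP]; exists d => // z zd; have /andP[z0 _] := zd.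
have := dP z zd; rewrite c0 add0r nrmZr gtr0_norm// exprS mulrCA.
by rewrite ler_pM2l.
Qed.

(** In Horner form [expansion_step] peels off one coefficient and one power of [z] at a time; the
    last coefficient is left below every [e]. *)
Lemma expansion_unique3 (R : realType) (Y : normedModType R[i]) (c0 c1 c2 c3 : Y) :
  (forall e : R, 0 < e -> exists2 d : R, 0 < d & forall z, 0 < z < d ->
    nrm (c0 + z%:C *: (c1 + z%:C *: (c2 + z%:C *: c3))) <= e * z ^+ 3) ->
  c2 = 0 /\ c3 = 0.
Proof.
have step (x y : Y) (z : R) : 0 < z < 1 -> nrm (x + z%:C *: y) <= nrm x + nrm y.
  move=> /andP[z0 z1]; rewrite (le_trans (nrmD _ _))// lerD2l nrmZr gtr0_norm//.
  by rewrite ler_piMl ?nrm_ge0// ltW.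
move=> H.
have [|_ {}H] := @expansion_step _ _ c0 _ (nrm c1 + (nrm c2 + nrm c3)) 2 _ H.
  by move=> z z1; rewrite (le_trans (step _ _ _ z1))// lerD2l step.
have [|_ {}H] := @expansion_step _ _ c1 _ (nrm c2 + nrm c3) 1 _ H.
  by move=> z z1; rewrite step.
have [//|-> {}H] := @expansion_step _ _ c2 (fun=> c3) (nrm c3) 0 _ H.
split=> //; apply: nrm_le_eps => e /H[d d0 /(_ (d / 2))].
by rewrite expr0 mulr1; apply; lra.
Qed.

(** * Expansion of the flow *)

Section HomogeneousParts.
Variables (R : realType) (X Y : normedModType R[i]) (f : X -> Y).

Lemma Dn0_2 (x y : X) : Dn0 f [tuple x; y] = frechetD (frechetD f) 0 x y.
Proof. by []. Qed.

Lemma homogeneous_part2 (x : X) :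
  homogeneous_part f 2 x = 2^-1 *: frechetD (frechetD f) 0 x x.
Proof. by []. Qed.

Lemma homogeneous_part3 (x : X) :
  homogeneous_part f 3 x = 6^-1 *: frechetD (frechetD (frechetD f)) 0 x x x.
Proof. by []. Qed.

End HomogeneousParts.

Section Expansion.
Variables (R : realType) (X : normedModType R[i]).
Variables (h : X -> X) (A : bounded_operator X (bounded_operator X X)).
Variables (C : bounded_operator X (bounded_operator X (bounded_operator X X))).
Variable (e : X).
Hypothesis A_sym : forall x y, A x y = A y x.

Let H2 : X := 2^-1 *: A e e.
Let H3 : X := 6^-1 *: C e e e.
Let B : X := A e H2.

(** The solution of [a' + a + q^3 H3 + (q^3 - q^2) B = 0] vanishing at [q = 1]; the last term is [A]
    applied to the coefficients [q e] and [(q^2 - q) H2] of orders 1 and 2. *)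
Definition coef3 (q : R[i]) : X :=
  ((q ^+ 3 - q) / 2) *: H3 + (q ^+ 3 / 2 - q ^+ 2 + q / 2) *: B.

(** [flow3 = z y] with [y = q e + z r]: the powers of [z] are pulled out so that homogeneity of [A]
    and [C] exposes the order of each term. *)
Let r (q z : R[i]) : X := (q ^+ 2 - q) *: H2 + z *: coef3 q.
Let y (q z : R[i]) : X := q *: e + z *: r q z.

(* The Taylor polynomial of degree 3 of the flow along [e]; [q] stands for
   [exp (- t)]. *)
Definition flow3 (q z : R[i]) : X :=
  (z * q) *: e + (z ^+ 2 * (q ^+ 2 - q)) *: H2 + z ^+ 3 *: coef3 q.

(* Obtained from [flow3] by [dq/dt = - q]. *)
Definition dflow3 (q z : R[i]) : X :=
  - (z * q) *: e + (z ^+ 2 * (q - 2 * q ^+ 2)) *: H2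
  + z ^+ 3 *: (((q - 3 * q ^+ 3) / 2) *: H3
               + (2 * q ^+ 2 - 3 * q ^+ 3 / 2 - q / 2) *: B).

Let flow3E q z : flow3 q z = z *: y q z.
Proof. by rewrite /flow3 /y /r; linear_identity; ring. Qed.

Let A_square (a b : X) (s t : R[i]) : A (s *: a + t *: b) (s *: a + t *: b)
  = s ^+ 2 *: A a a + (2 * s * t) *: A a b + t ^+ 2 *: A b b.
Proof.
rewrite (opD A) addopE !(opZ A) !scaleopE.
rewrite (opD (A a)) (opD (A b)) !(opZ (A a)) !(opZ (A b)) (A_sym b a).
by linear_identity; ring.
Qed.

Let C_cube (a : X) (s : R[i]) : C (s *: a) (s *: a) (s *: a) = s ^+ 3 *: C a a a.
Proof.
have E1 : C (s *: a) (s *: a) (s *: a) = s *: C a (s *: a) (s *: a).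
  by rewrite (opZ C).
have E2 : C a (s *: a) (s *: a) = s *: C a a (s *: a).
  by rewrite (opZ (C a)).
rewrite E1 E2 (opZ (C a a)); move: (C a a a) => x.
by linear_identity; ring.
Qed.

(** All terms up to [z^3] cancel. The cubic difference is left unexpanded: it is of order [z], since
    [y] differs from [q e] by [z r]. *)
Lemma flow3_residual (q z : R[i]) : let w := flow3 q z in
  dflow3 q z + (w + 2^-1 *: A w w + 6^-1 *: C w w w)
  = z ^+ 4 *: (q *: A e (coef3 q) + 2^-1 *: A (r q z) (r q z))
    + (z ^+ 3 / 6) *: (C (y q z) (y q z) (y q z) - q ^+ 3 *: C e e e).
Proof.
move=> w.
have Aee : A e e = 2 *: H2 by rewrite /H2 scalerA divff ?scale1r.
have Ceee : C e e e = 6 *: H3 by rewrite /H3 scalerA divff ?scale1r.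
have Aer : A e (r q z) = (q ^+ 2 - q) *: B + z *: A e (coef3 q).
  by rewrite /r opD (opZ (A e) (q ^+ 2 - q)) (opZ (A e) z).
have Aww : A w w = (z ^+ 2 * q ^+ 2) *: A e e + (2 * z ^+ 3 * q) *: A e (r q z)
    + z ^+ 4 *: A (r q z) (r q z).
  have -> : w = (z * q) *: e + z ^+ 2 *: r q z.
    by rewrite /w flow3E /y; move: (r q z) => x; linear_identity; ring.
  rewrite A_square; move: (A (r q z) (r q z)) (A e (r q z)) => x1 x2.
  by linear_identity; ring.
have Cww : C w w w = z ^+ 3 *: C (y q z) (y q z) (y q z).
  by rewrite /w flow3E C_cube.
rewrite Aww Cww Aer Aee Ceee /w /flow3 /dflow3.
move: (A e (coef3 q)) (A (r q z) (r q z)) (C (y q z) (y q z) (y q z)) => x1 x2 x3.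
by rewrite /coef3; linear_identity; field.
Qed.

End Expansion.

Section FlowApproximation.
Variables (R : realType) (X : normedModType R[i]).
Variables (h : X -> X) (A : bounded_operator X (bounded_operator X X)).
Variables (C : bounded_operator X (bounded_operator X (bounded_operator X X))).
Variables (e : X) (K rho : R).
Hypothesis e1 : nrm e = 1.
Hypothesis A_sym : forall x y, A x y = A y x.
Hypotheses (K0 : 0 <= K) (rho0 : 0 < rho).
Hypothesis h_lip : forall x y, nrm x < rho -> nrm y < rho ->
  nrm (h x - h y) <= K * nrm (x - y).
Hypothesis h_taylor : forall d : R, 0 < d -> exists2 s : R, 0 < s &
  forall x, nrm x < s ->
    nrm (h x - x - 2^-1 *: A x x - 6^-1 *: C x x x) <= d * nrm x ^+ 3.

Let H2 : X := 2^-1 *: A e e.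
Let H3 : X := 6^-1 *: C e e e.
Let B : X := A e H2.
Let w (q z : R) : X := flow3 A C e q%:C z%:C.
Let w' (q z : R) : X := dflow3 A C e q%:C z%:C.

(** [P], [Q], [S] bound [coef3], [r], [y], and [Z] the residual divided by [z^4], uniformly for [q]
    and [z] in [[0, 1]]. *)
Let P := nrm H3 + 2 * nrm B.
Let Q := nrm H2 + P.
Let S := 1 + Q.
Let Z := nrm A * P + nrm A * Q ^+ 2 + nrm C * S ^+ 2 * Q.

Let PQS : [/\ 0 <= P, 0 <= Q, 1 <= S & 0 <= Z].
Proof.
have p0 : 0 <= P by rewrite addr_ge0 ?mulr_ge0 ?nrm_ge0.
have q0 : 0 <= Q by rewrite addr_ge0 ?nrm_ge0.
have s1 : 1 <= S by rewrite lerDl.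
by split => //; rewrite !addr_ge0 ?mulr_ge0 ?nrm_ge0 ?exprn_ge0//; lra.
Qed.

Let coef3_le (q : R) : 0 <= q <= 1 -> nrm (coef3 A C e q%:C) <= P.
Proof.
move=> /andP[q0 q1].
have -> : coef3 A C e q%:C
    = ((q ^+ 3 - q) / 2)%:C *: H3 + (q ^+ 3 / 2 - q ^+ 2 + q / 2)%:C *: B.
  have c1 : ((q ^+ 3 - q) / 2)%:C = (q%:C ^+ 3 - q%:C) / 2.
    by field.
  have c2 : (q ^+ 3 / 2 - q ^+ 2 + q / 2)%:C = q%:C ^+ 3 / 2 - q%:C ^+ 2 + q%:C / 2.
    by field.
  by rewrite c1 c2.
have q2 : 0 <= q ^+ 2 <= 1 by rewrite exprn_ge0// exprn_ile1.
have q3 : 0 <= q ^+ 3 <= 1 by rewrite exprn_ge0// exprn_ile1.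
move: q2 q3 => /andP[? ?] /andP[? ?].
rewrite (le_trans (nrmD _ _))// !nrmZr lerD//.
  by rewrite ler_piMl ?nrm_ge0// ler_norml; lra.
by rewrite ler_wpM2r ?nrm_ge0// ler_norml; lra.
Qed.

Let r (q z : R) : X := (q%:C ^+ 2 - q%:C) *: H2 + z%:C *: coef3 A C e q%:C.
Let y (q z : R) : X := q%:C *: e + z%:C *: r q z.

Let r_le (q z : R) : 0 <= q <= 1 -> 0 <= z <= 1 -> nrm (r q z) <= Q.
Proof.
move=> q01 /andP[z0 z1]; have /andP[q0 q1] := q01.
have -> : r q z = (q ^+ 2 - q)%:C *: H2 + z%:C *: coef3 A C e q%:C.
  by rewrite /r rmorphB rmorphXn.
rewrite (le_trans (nrmD _ _))// !nrmZr lerD//.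
  by rewrite ler_piMl ?nrm_ge0// ler_norml; nra.
rewrite ger0_norm// (le_trans _ (coef3_le q01))//.
by rewrite ler_piMl ?nrm_ge0.
Qed.

Let y_le (q z : R) : 0 <= q <= 1 -> 0 <= z <= 1 -> nrm (y q z) <= S.
Proof.
move=> q01 z01; have /andP[q0 q1] := q01; have /andP[z0 z1] := z01.
rewrite (le_trans (nrmD _ _))// !nrmZr e1 mulr1 !ger0_norm// lerD//.
by rewrite (le_trans _ (r_le q01 z01))// ler_piMl ?nrm_ge0.
Qed.

Let w_y (q z : R) : w q z = z%:C *: y q z.
Proof. by rewrite /w /flow3 /y /r /H2; linear_identity; ring. Qed.

Let app2_le x1 x2 : nrm (A x1 x2) <= nrm A * nrm x1 * nrm x2.
Proof.
by rewrite (le_trans (nrm_app _ _))// ler_wpM2r ?nrm_ge0// nrm_app.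
Qed.

Let app3_le x1 x2 x3 : nrm (C x1 x2 x3) <= nrm C * nrm x1 * nrm x2 * nrm x3.
Proof.
rewrite (le_trans (nrm_app _ _))// ler_wpM2r ?nrm_ge0//.
by rewrite (le_trans (nrm_app _ _))// ler_wpM2r ?nrm_ge0// nrm_app.
Qed.

(** Replacing [y] by [q e] one slot at a time gives three terms, each with one argument [z r] of
    norm at most [z Q]. *)
Let cube_le (q z : R) : 0 <= q <= 1 -> 0 <= z <= 1 ->
  nrm (C (y q z) (y q z) (y q z) - q%:C ^+ 3 *: C e e e)
    <= 3 * z * (nrm C * S ^+ 2 * Q).
Proof.
move=> q01 z01; have /andP[q0 q1] := q01; have /andP[z0 z1] := z01.
have [p0 Q0 s1 _] := PQS.
pose a := q%:C *: e; pose b := z%:C *: r q z.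
have na : nrm a <= S by rewrite nrmZr e1 mulr1 ger0_norm//; lra.
have nb : nrm b <= z * Q by rewrite nrmZr ger0_norm// ler_wpM2l// r_le.
have ny : nrm (y q z) <= S by apply: y_le.
have Ea : C a a a = q%:C ^+ 3 *: C e e e.
  have E1 : C a a a = q%:C *: C e a a by rewrite (opZ C).
  have E2 : C e a a = q%:C *: C e e a by rewrite (opZ (C e)).
  by rewrite E1 E2 (opZ (C e e)); move: (C e e e) => x; linear_identity; ring.
have yE : y q z = a + b by [].
have E : C (y q z) (y q z) (y q z) - C a a a
    = C b (y q z) (y q z) + (C a b (y q z) + C a a b).
  have E1 : C (y q z) (y q z) (y q z) = C a (y q z) (y q z) + C b (y q z) (y q z).
    by rewrite {1}yE (opD C).
  have E2 : C a (y q z) (y q z) = C a a (y q z) + C a b (y q z).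
    by rewrite {1}yE (opD (C a)).
  have E3 : C a a (y q z) = C a a a + C a a b by rewrite yE (opD (C a a)).
  by rewrite E1 E2 E3; linear_identity; ring.
rewrite -Ea E.
have bound x1 x2 x3 c1 c2 c3 : nrm x1 <= c1 -> nrm x2 <= c2 -> nrm x3 <= c3 ->
    nrm (C x1 x2 x3) <= nrm C * c1 * c2 * c3.
  move=> h1 h2 h3; rewrite (le_trans (app3_le _ _ _))//.
  by rewrite !ler_pM ?mulr_ge0 ?nrm_ge0.
have b1 := bound _ _ _ _ _ _ nb ny ny.
have b2 := bound _ _ _ _ _ _ na nb ny.
have b3 := bound _ _ _ _ _ _ na na nb.
rewrite (le_trans (nrmD _ _))// (le_trans (lerD b1 (nrmD _ _)))//.
apply: le_trans (lerD (lexx _) (lerD b2 b3)) _.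
by rewrite le_eqVlt; apply/orP; left; apply/eqP; ring.
Qed.

Let residual_le (d : R) : 0 < d -> exists2 s : R, 0 < s &
  forall q z, 0 <= q <= 1 -> 0 < z < s ->
    nrm (w' q z + h (w q z)) <= d * z ^+ 3 /\ nrm (w q z) < rho / 2.
Proof.
move=> d0; have [P0 Q0 S1 Z0] := PQS.
have S3 : 0 < 2 * S ^+ 3 by rewrite mulr_gt0// exprn_gt0//; lra.
have [s s0 sP] := h_taylor (divr_gt0 d0 S3).
(* In turn: the bounds for [z <= 1] apply, [w] is in the range of [h_taylor], [z^4 Z] is at most
   [d / 2 * z^3], and [w] has norm below [rho / 2]. *)
pose s' := Num.min (Num.min 1 (s / S)) (Num.min (d / (2 * (Z + 1))) (rho / (2 * S))).
have S0 : 0 < S by lra.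
have Z1 : 0 < 2 * (Z + 1) by lra.
have s'0 : 0 < s' by rewrite !lt_min ltr01 !divr_gt0// mulr_gt0.
exists s' => // q z q01 /andP[z0]; rewrite !lt_min => /andP[/andP[z1 zs] /andP[zd zr]].
have z01 : 0 <= z <= 1 by rewrite !ltW.
have nw : nrm (w q z) <= z * S by rewrite w_y nrmZr gtr0_norm// ler_pM2l// y_le.
rewrite ltr_pdivlMr// in zs; rewrite ltr_pdivlMr// in zd.
rewrite ltr_pdivlMr ?mulr_gt0// in zr.
split; last by lra.
have hw := sP (w q z) (le_lt_trans nw zs).
have -> : w' q z + h (w q z) =
    (w' q z + (w q z + 2^-1 *: A (w q z) (w q z) + 6^-1 *: C (w q z) (w q z) (w q z)))
    + (h (w q z) - w q z - 2^-1 *: A (w q z) (w q z) - 6^-1 *: C (w q z) (w q z) (w q z)).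
  move: (A (w q z) (w q z)) (C (w q z) (w q z) (w q z)) (h _) => x1 x2 x3.
  by linear_identity; ring.
have -> : w' q z + (w q z + 2^-1 *: A (w q z) (w q z) + 6^-1 *: C (w q z) (w q z) (w q z))
    = z%:C ^+ 4 *: (q%:C *: A e (coef3 A C e q%:C) + 2^-1 *: A (r q z) (r q z))
      + (z%:C ^+ 3 / 6) *: (C (y q z) (y q z) (y q z) - q%:C ^+ 3 *: C e e e).
  exact: flow3_residual C e A_sym q%:C z%:C.
have hw' : d / (2 * S ^+ 3) * nrm (w q z) ^+ 3 <= d / 2 * z ^+ 3.
  have h3 : nrm (w q z) ^+ 3 <= (z * S) ^+ 3.
    by rewrite lerXn2r ?nnegrE ?nrm_ge0// mulr_ge0 ?ltW.
  rewrite (le_trans (ler_wpM2l _ h3)) ?divr_ge0 ?(ltW d0) ?(ltW S3)//.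
  by rewrite le_eqVlt; apply/orP; left; apply/eqP; field; rewrite gt_eqF.
have Aec : nrm (A e (coef3 A C e q%:C)) <= nrm A * P.
  by rewrite (le_trans (app2_le _ _))// e1 mulr1 ler_wpM2l ?nrm_ge0// coef3_le.
have Arr : nrm (A (r q z) (r q z)) <= nrm A * Q ^+ 2.
  rewrite (le_trans (app2_le _ _))// expr2 mulrA.
  by rewrite !ler_pM ?mulr_ge0 ?nrm_ge0 ?r_le.
have cube := cube_le q01 z01.
have /andP[q0 q1] := q01.
set x1 := A e _ in Aec *; set x2 := A _ _ in Arr *; set x3 := C _ _ _ - _ in cube *.
have -> : z%:C ^+ 4 *: (q%:C *: x1 + 2^-1 *: x2) + (z%:C ^+ 3 / 6) *: x3
    = (z ^+ 4 * q)%:C *: x1 + (z ^+ 4 / 2)%:C *: x2 + (z ^+ 3 / 6)%:C *: x3.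
  by linear_identity; field.
have z3 : 0 < z ^+ 3 by rewrite exprn_gt0.
have z4 : 0 < z ^+ 4 by rewrite exprn_gt0.
have N1 : nrm ((z ^+ 4 * q)%:C *: x1) <= z ^+ 4 * (nrm A * P).
  rewrite nrmZr (ger0_norm (mulr_ge0 (ltW z4) q0)) -mulrA ler_pM2l//.
  by rewrite (le_trans _ Aec)// ler_piMl ?nrm_ge0.
have N2 : nrm ((z ^+ 4 / 2)%:C *: x2) <= z ^+ 4 * (nrm A * Q ^+ 2).
  rewrite nrmZr (ger0_norm (divr_ge0 (ltW z4) (ler0n _ 2))) -mulrA ler_pM2l//.
  by rewrite (le_trans _ Arr)// ler_piMl ?nrm_ge0//; lra.
have N3 : nrm ((z ^+ 3 / 6)%:C *: x3) <= z ^+ 4 * (nrm C * S ^+ 2 * Q).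
  have z6 := divr_ge0 (ltW z3) (ler0n R 6).
  rewrite nrmZr (ger0_norm z6) (le_trans (ler_wpM2l z6 cube))//.
  have C0 : 0 <= nrm C * S ^+ 2 * Q by rewrite mulr_ge0// mulr_ge0 ?nrm_ge0 ?sqr_ge0.
  have -> : z ^+ 3 / 6 * (3 * z * (nrm C * S ^+ 2 * Q)) =
    2^-1 * (z ^+ 4 * (nrm C * S ^+ 2 * Q)) by field.
  by rewrite (ler_piMl (mulr_ge0 (ltW z4) C0))//; lra.
have N4 : z ^+ 4 * Z <= d / 2 * z ^+ 3.
  rewrite exprSr -mulrA mulrC ler_pM2r//; nra.
apply: le_trans (nrmD _ _) _; apply: le_trans (lerD (nrmD _ _) hw) _.
apply: le_trans (lerD (lerD (nrmD _ _) (lexx _)) hw') _.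
have {}N4 : z ^+ 4 * (nrm A * P) + z ^+ 4 * (nrm A * Q ^+ 2)
    + z ^+ 4 * (nrm C * S ^+ 2 * Q) <= d / 2 * z ^+ 3.
  by move: N4; rewrite /Z (mulrDr (z ^+ 4)) (mulrDr (z ^+ 4)).
have -> : d * z ^+ 3 = d / 2 * z ^+ 3 + d / 2 * z ^+ 3 by field.
rewrite lerD2r; apply: le_trans N4.
by rewrite !lerD.
Qed.

(* [exp (- k t)] enters [flow3] through the powers of [q = exp (- t)]. *)
Let w_der (z t : R) : rder (fun s => w (expR (- s)) z) t (w' (expR (- t)) z).
Proof.
pose V1 : X := z%:C *: e - z%:C ^+ 2 *: H2 + (z%:C ^+ 3 / 2) *: (B - H3).
pose V2 : X := z%:C ^+ 2 *: H2 - z%:C ^+ 3 *: B.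
pose V3 : X := (z%:C ^+ 3 / 2) *: (H3 + B).
have wE : (fun s => w (expR (- s)) z) = fun s =>
   (expR (- s))%:C *: V1 + (expR (- s) ^+ 2)%:C *: V2 + (expR (- s) ^+ 3)%:C *: V3.
  apply/funext => s; rewrite /w /flow3 /coef3 /V1 /V2 /V3 -/H2 -/H3 -/B.
  by linear_identity; field.
have -> : w' (expR (- t)) z = (- expR (- t))%:C *: V1
   + (- (2 * expR (- t) ^+ 2))%:C *: V2 + (- (3 * expR (- t) ^+ 3))%:C *: V3.
  rewrite /w' /dflow3 /V1 /V2 /V3 -/H2 -/H3 -/B.
  by linear_identity; field.
rewrite wE; apply: rderD; [apply: rderD|]; apply: rder_scale.
- by apply: is_derive_eq; rewrite /GRing.scale /=; ring.
- by apply: is_derive_eq; rewrite /GRing.scale /=; ring.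
- by apply: is_derive_eq; rewrite /GRing.scale /=; ring.
Qed.

Lemma flow_approximation (v : R -> R -> X) (T : R) : 0 <= T ->
  (forall z : R, 0 < z < 1 -> v z 0 = z%:C *: e /\
    forall t : R, 0 <= t <= T -> forall d : R, 0 < d -> exists2 s' : R, 0 < s' &
      forall s : R, 0 <= s -> `|s - t| < s' ->
        nrm (v z s - v z t + (s - t)%:C *: h (v z t)) <= d * `|s - t|) ->
  forall d : R, 0 < d -> exists2 s : R, 0 < s & forall z : R, 0 < z < s ->
    nrm (v z T - w (expR (- T)) z) <= d * z ^+ 3.
Proof.
move=> T0 vP d d0; pose G := expR ((K + 1) * T).
have G0 : 0 < G by exact: expR_gt0.
have G2 : 0 < 2 * G by lra.
have [s s0 sP] := residual_le (divr_gt0 d0 G2).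
(* The last bound keeps the barrier at time [T], which is [d z^3 <= d z], below [rho / 2]. *)
exists (Num.min (Num.min 1 s) (rho / (2 * d))).
  by rewrite !lt_min ltr01 s0 divr_gt0// mulr_gt0.
move=> z /andP[z0]; rewrite !lt_min => /andP[/andP[z1 zs] zr].
have [|v0 v_der] := vP z; first by rewrite z0.
rewrite ltr_pdivlMr ?mulr_gt0// in zr.
have z3 : 0 < z ^+ 3 by rewrite exprn_gt0.
pose eta := d / (2 * G) * z ^+ 3.
have eta0 : 0 < eta by rewrite mulr_gt0// divr_gt0.
have etaE : 2 * eta * G = d * z ^+ 3 by rewrite /eta; field; rewrite gt_eqF.
have q01 (t : R) : 0 <= t -> 0 <= expR (- t) <= 1.
  by move=> t0; rewrite ltW ?expR_gt0// -[leRHS]expR0 ler_expR oppr_le0.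
rewrite -etaE; apply: (approximate_solution K0 eta0 h_lip v_der (w_der z)).
- by move=> t /andP[t0 _]; have [] := sP _ z (q01 t t0) _; rewrite ?z0.
- by move=> t /andP[t0 _]; have [] := sP _ z (q01 t t0) _; rewrite ?z0.
- by rewrite v0 oppr0 expR0 /w /flow3 /coef3; linear_identity; field.
- rewrite -/G etaE; have zz : z ^+ 3 <= z by rewrite exprS (ler_piMr (ltW z0))// exprn_ile1 ?ltW.
  by have := ler_wpM2l (ltW d0) zz; lra.
- by rewrite T0 lexx.
Qed.

End FlowApproximation.

(** * From the initial value problem to the Taylor coefficients *)

Lemma solves_ivp_dist (R : realType) (X : normedModType R[i]) (h : X -> X)
    (v : R -> X) x : solves_ivp h v x ->
  forall t : R, 0 <= t -> forall d : R, 0 < d -> exists2 s' : R, 0 < s' &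
    forall s : R, 0 <= s -> `|s - t| < s' ->
      nrm (v s - v t + (s - t)%:C *: h (v t)) <= d * `|s - t|.
Proof.
move=> [_ H] t t0 d d0.
have := H t t0 => /cvgrPdist_lt/(_ d%:C); rewrite ltcR => /(_ d0).
move=> /nbhs_ballP[r /= r0 rP]; exists r => // s s0 sr.
have [->|st] := eqVneq s t.
  by rewrite !subrr scale0r addr0 nrm0 normr0 mulr0.
have st0 : s - t != 0 by rewrite subr_eq0.
have := rP s; rewrite /ball /= distrC => /(_ sr st s0).
rewrite nrmC ltcR => /ltW Hs.
have E : (s - t)%:C * ((s - t)%:C)^-1 = 1 :> R[i] by rewrite divff// (inj_eq (@complexI R) _ 0).
have -> : v s - v t + (s - t)%:C *: h (v t)
    = - ((s - t)%:C *: (- h (v t) - ((s - t)%:C)^-1 *: (v s - v t))).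
  by rewrite scalerBr scalerA E scale1r; linear_identity; ring.
by rewrite nrmN nrmZr mulrC ler_wpM2r.
Qed.

Lemma unit_ball_nrm (R : realType) (X : normedModType R[i]) (x : X) :
  unit_ball x <-> nrm x < 1.
Proof. by rewrite /unit_ball -(nrm_lt_ball x 1). Qed.

Theorem theorem5p1 (R : realType) (X : completeNormedModType R[i])
  (h : X -> X) (u : R -> X -> X) :
  class_M h -> semigroup_generated_by h u ->
  forall (e : X) (t : R), `|e| = 1 -> 0 <= t ->
  homogeneous_part (u t) 2 e
    = (expR (- t) * (expR (- t) - 1))%:C *: homogeneous_part h 2 e
  /\
  forall es : dual X, duality_map e es ->
  let lambda : R[i] := (2 * (1 - expR (- t)) / (1 + expR (- t)))%:C in
  homogeneous_part (u t) 3 e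
    = (expR (- t) * (expR (- (2 * t)) - 1) / 2)%:C
        *: Fekete_Szego e es h lambda lambda.
Proof.
move=> [[hHol h0 dh0] _] [uHol u_ivp] e T e1 T0.
have {}e1 : nrm e = 1 by rewrite /nrm e1.
have c0 := complete_seq_complete (Y := X).
have c1 := bounded_operator_seq_complete (X := X) c0.
have HolE (f : X -> X) : Hol f -> holo f (0 : X) (1 : R).
  by move=> fH x; rewrite subr0 => /unit_ball_nrm/fH.
have hh := HolE h hHol; have hu := HolE _ (uHol T T0).1.
have zero_in : nrm (0 - 0 : X) < 1 by rewrite subrr nrm0.
(* Completeness of [X] makes [Dh] differentiable, and completeness of L(X, X) makes [D^2h]
   differentiable: the third derivative is not the default value 0 of [frechetD]. *)
have Dh := holo_frechetD c0 hh; have DDh := holo_frechetD c1 Dh.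
have Du := holo_frechetD c0 hu; have DDu := holo_frechetD c1 Du.
set A := frechetD (frechetD h) 0; set C := frechetD (frechetD (frechetD h)) 0.
have hC := differentiable_fder (DDh 0 zero_in).
have uC := differentiable_fder (DDu 0 zero_in).
have [s [M [s0 hs hM]]] := holo_locally_bounded ltr01 hh.
have A_sym x y : A x y = A y x by have := frechetD2_sym c0 x y ltr01 hh.
have M0 : 0 <= M by rewrite (le_trans (nrm_ge0 (h 0)))// hM// subrr nrm0.
have K0 : 0 <= 16 * M / s by rewrite divr_ge0 ?mulr_ge0// ltW.
have rho0 : 0 < s / 2 by lra.
have h_lip x y : nrm x < s / 2 -> nrm y < s / 2 -> nrm (h x - h y) <= 16 * M / s * nrm (x - y).
  move=> xs ys; have := @holo_lipschitz _ _ _ h 0 s M s0 hs hM y (x - y).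
  by rewrite (addrC y (x - y)) subrK !subr0 => /(_ ys xs).
have h_taylor d : 0 < d -> exists2 s : R, 0 < s & forall x, nrm x < s ->
    nrm (h x - x - 2^-1 *: A x x - 6^-1 *: C x x x) <= d * nrm x ^+ 3.
  move=> d0; have [r r0 rP] := taylor3 ltr01 hh Dh (erefl A) hC d0.
  exists r => // x /rP; rewrite h0 subr0 frechetDE ?dh0//.
  exact: hh.
have approx := flow_approximation (C := C) e1 A_sym K0 rho0 h_lip h_taylor
  (v := fun z t => u t (z%:C *: e)) T0.
have {}approx : forall d : R, 0 < d -> exists2 s : R, 0 < s & forall z : R, 0 < z < s ->
    nrm (u T (z%:C *: e) - flow3 A C e (expR (- T))%:C z%:C) <= d * z ^+ 3.
  apply: approx => z /andP[z0 z1].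
  have [|v0 _] := u_ivp (z%:C *: e).
    by apply/unit_ball_nrm; rewrite nrmZr e1 mulr1 gtr0_norm.
  split=> // t /andP[t0 _]; apply: solves_ivp_dist t0.
  by apply: u_ivp; apply/unit_ball_nrm; rewrite nrmZr e1 mulr1 gtr0_norm.
set q := expR (- T) in approx *.
pose A' := frechetD (frechetD (u T)) 0; pose C' := frechetD (frechetD (frechetD (u T))) 0.
pose H2 : X := 2^-1 *: A e e.
(* The value [uz] of the flow cancels between the error of the approximate solution and the Taylor
   remainder of the flow, leaving the coefficient differences in Horner form. *)
have aux (uz p3 a2 a3 a1 a0 : X) (c z : R[i]) :
    a0 + z *: (a1 - c *: e + z *: (2^-1 *: a2 - (c ^+ 2 - c) *: H2
      + z *: (6^-1 *: a3 - p3)))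
    = (uz - ((z * c) *: e + (z ^+ 2 * (c ^+ 2 - c)) *: H2 + z ^+ 3 *: p3))
     - (uz - a0 - z *: a1 - 2^-1 *: (z *: (z *: a2))
        - 6^-1 *: (z *: (z *: (z *: a3)))).
  by move: H2 => H2'; linear_identity; ring.
have [] : 2^-1 *: A' e e - (q%:C ^+ 2 - q%:C) *: H2 = 0 /\
    6^-1 *: C' e e e - coef3 A C e q%:C = 0.
  apply: (@expansion_unique3 _ _ (u T 0) (frechetD (u T) 0 e - q%:C *: e)) => d d0.
  have d2 : 0 < d / 2 by lra.
  have [r1 r10 r1P] := approx _ d2.
  have [r2 r20 r2P] := taylor3 ltr01 hu Du (erefl A') uC d2.
  exists (Num.min r1 r2) => [|z /andP[z0]]; first by rewrite lt_min r10.
  rewrite lt_min => /andP[zr1 zr2].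
  have := r1P z; rewrite z0 zr1 => /(_ isT) P1.
  have nz : nrm (z%:C *: e) = z by rewrite nrmZr e1 mulr1 gtr0_norm.
  have := r2P (z%:C *: e); rewrite nz => /(_ zr2) P2.
  rewrite -/C' in P2.
  have E1 : frechetD (u T) 0 (z%:C *: e) = z%:C *: frechetD (u T) 0 e by rewrite opZ.
  have E2 : A' (z%:C *: e) (z%:C *: e) = z%:C *: (z%:C *: A' e e).
    have E : A' (z%:C *: e) (z%:C *: e) = z%:C *: A' e (z%:C *: e) by rewrite (opZ A').
    by rewrite E (opZ (A' e)).
  have E3 : C' (z%:C *: e) (z%:C *: e) (z%:C *: e)
      = z%:C *: (z%:C *: (z%:C *: C' e e e)).
    have F1 : C' (z%:C *: e) (z%:C *: e) (z%:C *: e) = z%:C *: C' e (z%:C *: e) (z%:C *: e).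
      by rewrite (opZ C').
    have F2 : C' e (z%:C *: e) (z%:C *: e) = z%:C *: C' e e (z%:C *: e).
      by rewrite (opZ (C' e)).
    by rewrite F1 F2 (opZ (C' e e)).
  rewrite E1 E2 E3 in P2.
  rewrite (aux (u T (z%:C *: e)) (coef3 A C e q%:C)).
  rewrite (le_trans (nrm_sub_le _ _))//.
  have -> : d * z ^+ 3 = d / 2 * z ^+ 3 + d / 2 * z ^+ 3 by field.
  exact: lerD P1 P2.
move=> /subr0_eq a2E /subr0_eq a3E; 
have h2 : homogeneous_part h 2 e = H2 := homogeneous_part2 h e.
have h3 : homogeneous_part h 3 e = 6^-1 *: C e e e := homogeneous_part3 h e.
have u2 : homogeneous_part (u T) 2 e = 2^-1 *: A' e e := homogeneous_part2 (u T) e.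
have u3 : homogeneous_part (u T) 3 e = 6^-1 *: C' e e e := homogeneous_part3 (u T) e.
have hB : Dn0 h [tuple e; H2] = A e H2 := Dn0_2 h e H2.
split; first by rewrite u2 h2 a2E; congr (_ *: _); ring.
move=> es _ lambda.
have FS : Fekete_Szego e es h lambda lambda = 6^-1 *: C e e e - (lambda / 2) *: A e H2
    - ((lambda - lambda) * dual_pairing H2 es) *: H2.
  rewrite /Fekete_Szego.
  rewrite h2.
  rewrite h3.
  by rewrite hB.
(* Here [q^3 / 2 - q^2 + q / 2 = q (1 - q)^2 / 2], which equals [- lambda / 2] times
   [(q^3 - q) / 2]; the division by [1 + q] is legitimate because [q > 0]. *)
have cE : coef3 A C e q%:C = ((q%:C ^+ 3 - q%:C) / 2) *: (6^-1 *: C e e e)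
    + (q%:C ^+ 3 / 2 - q%:C ^+ 2 + q%:C / 2) *: A e H2 by [].
rewrite u3 a3E cE FS /lambda.
have q2 : expR (- (2 * T)) = q ^+ 2.
  by rewrite /q expr2 -expRD; congr expR; ring.
have q1 : 1 + q != 0 by rewrite gt_eqF// ltr_pwDr ?expR_gt0.
have q1C : 1 + q%:C != 0 :> R[i].
  by rewrite -(rmorph1 (real_complex R)) -rmorphD fmorph_eq0.
rewrite q2 subrr mul0r scale0r subr0.
move: (6^-1 *: C e e e) (A e H2) => H3 B.
by linear_identity; field; exact: q1C.
Qed.
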